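(* Let $U=\{z\in\mathbb{C}:|z|<1\}$, let $E\subset U$ be a set containing infinitely many points, let $1\le p\le\infty$ and $R\in(0,1)$. Suppose $E$ contains a sequence $(z_j)$ with $\sum_{j=1}^\infty(1-|z_j|)=\infty$. Then \[ \lim_{\varepsilon\to 0^+} C_p(\varepsilon,R)=0 . \]
   Context: $H^p=H^p(U)$ is the Hardy space of holomorphic $g$ on $U$ with $\|g\|_p<\infty$, where $\|g\|_p=\lim_{r\uparrow1}\left(\frac1{2\pi}\int_0^{2\pi}|g(re^{i\theta})|^pd\theta\right)^{1/p}$ for $1\le p<\infty$ and $\|g\|_\infty=\lim_{r\uparrow1}\sup_\theta|g(re^{i\theta})|$. For $\varepsilon>0$ and $R\in(0,1)$, \[ C_p(\varepsilon,R)=\sup\Big\{\sup_{|z|\le R}|g(z)| : g\in H^p,\ \|g\|_p\le1,\ |g(\zeta)|\le\varepsilon\ \forall \zeta\in E\Big\}. \]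
   Formalization: The sequence (z_j) in E is required to consist of distinct points; with repetitions allowed the claim fails (E an infinite Blaschke set containing 0, with z_j = 0 for all j). *)

(* Defs.v *)
From Stdlib Require Import Reals Lra.
From Coquelicot Require Import Coquelicot.
Open Scope R_scope.

Definition in_disc (z : C) : Prop := Cmod z < 1.

Definition holomorphic_on_disc (g : C -> C) : Prop :=
  forall z : C, in_disc z -> @ex_derive C_AbsRing C_NormedModule g z.

Definition rpow (x p : R) : R :=
  if Req_EM_T x 0 then 0 else Rpower x p.

Definition polar (r t : R) : C := (r * cos t, r * sin t).

Definition hardy_mean (p : Rbar) (g : C -> C) (r : R) : R :=
  match p with
  | Finite q =>
      rpow (/ (2 * PI) * RInt (fun t => rpow (Cmod (g (polar r t))) q) 0 (2 * PI))
           (/ q)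
  | _ => real (Lub_Rbar (fun y => exists t : R, y = Cmod (g (polar r t))))
  end.

Definition in_Hp_unit_ball (p : Rbar) (g : C -> C) : Prop :=
  holomorphic_on_disc g /\
  exists L : R,
    filterlim (hardy_mean p g) (at_left 1) (locally L) /\ L <= 1.

Definition Cp (p : Rbar) (E : C -> Prop) (eps Rad : R) : Rbar :=
  Lub_Rbar (fun x => exists (g : C -> C) (z : C),
    in_Hp_unit_ball p g /\
    (forall zeta, E zeta -> Cmod (g zeta) <= eps) /\
    Cmod z <= Rad /\ x = Cmod (g z)).

(* Main.v *)
(* Let z_1, ..., z_n be the first n points, w the polynomial with these zeros and B the
   finite Blaschke product w/v. For g in the unit ball put G = g v. The partial fraction
   expansion 1/w = sum_j c_j / (zeta - z_j) and Cauchy's formula give Hermite's remainder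
   formula on |zeta| = r
     G(z) = sum_j c_j G(z_j) w(z) / (z - z_j)
            + w(z) (1/2pi) int G(zeta) / w(zeta) * zeta / (zeta - z) dt.
   Dividing by v(z), the sum is at most K_n eps and the remainder at most
   |B(z)| sup_{|zeta|=r} 1/|B| * 1/(r - |z|) * (mean of |g| on |zeta| = r). For r close to 1,
   depending on n, 1/|B| is at most 2 on the circle, and the mean of |g| is bounded in
   terms of p because x <= 1 + x^p. Finally |B(z)| tends to 0 uniformly on |z| <= R because
   sum (1 - |z_j|) diverges; so one chooses n first and eps afterwards. *)
Require Import Defs.
From Stdlib Require Import Reals ZArith List Lra Lia.
From Coquelicot Require Import Coquelicot.
Open Scope R_scope.

(** * Continuity and differentiability of complex functions *)

(** The factor v keeps the constant on the circle independent of n. With w alone, |w(z)| divided by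
    the minimum of |w| on the circle need not be small, since zeros may crowd near one boundary
    point; but G / w = g / B, and |B| tends to 1 at the boundary. The price is |v| <= 2^n at the
    nodes and |v(z)| >= (1 - R)^n, which affects only the term carrying eps. Uniformity in g is the
    delicate point. The radius r depends on g, because the means are only known to be near their
    limit eventually. The final bound sees r only through r - R >= (1 - R)/2 and 1/|B| <= 2, and K_n
    is fixed before g appears. Holomorphy here means differentiability at each point, with no
    continuity of the derivative, so Cauchy's formula has to rest on Goursat's argument. That
    argument is run on a parameter square mapped into the plane, so that a homotopy of circles can
    be inserted directly, without cutting an annulus. Hermite's formula excludes z equal to a node;
    at a node the hypothesis on E bounds g(z) at once. *)

Definition is_CInt (f : R -> C) (a b : R) (l : C) : Prop :=
  @is_RInt C_R_NormedModule f a b l.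

Definition ccont (f : R -> C) (x : R) : Prop :=
  @continuous R_UniformSpace C_UniformSpace f x.

Definition cderiv (f : R -> C) (x : R) (l : C) : Prop :=
  is_derive (fun t => Re (f t)) x (Re l) /\ is_derive (fun t => Im (f t)) x (Im l).

(** First-order expansion with the remainder measured by [Cmod]: the form that Goursat's local
    estimate consumes. [ex_derive_cdiff] reaches it from the derivative in [holomorphic_on_disc]. *)
Definition cdiff (k : C -> C) (p : C) : Prop :=
  exists d : C, forall eta, 0 < eta -> exists delta, 0 < delta /\
    forall w, Cmod (w - p) < delta ->
      Cmod (k w - k p - d * (w - p)) <= eta * Cmod (w - p).

Lemma ccont_pair (f : R -> C) (x : R) :
  continuous (fun t => Re (f t)) x -> continuous (fun t => Im (f t)) x -> ccont f x.
Proof.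
  intros H1 H2 P [d Hd].
  destruct (H1 _ (locally_ball _ d)) as [d1 Hd1].
  destruct (H2 _ (locally_ball _ d)) as [d2 Hd2].
  assert (Hm : 0 < Rmin d1 d2) by (apply Rmin_pos; [apply d1 | apply d2]).
  exists (mkposreal _ Hm). intros y Hy. apply Hd. split.
  - apply Hd1. eapply ball_le; [apply Rmin_l | exact Hy].
  - apply Hd2. eapply ball_le; [apply Rmin_r | exact Hy].
Qed.

Lemma ccont_Re (f : R -> C) (x : R) : ccont f x -> continuous (fun t => Re (f t)) x.
Proof.
  intros H P [d Hd].
  destruct (H _ (locally_ball _ d)) as [e He].
  exists e. intros y Hy. apply Hd. exact (proj1 (He y Hy)).
Qed.

Lemma ccont_Im (f : R -> C) (x : R) : ccont f x -> continuous (fun t => Im (f t)) x.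
Proof.
  intros H P [d Hd].
  destruct (H _ (locally_ball _ d)) as [e He].
  exists e. intros y Hy. apply Hd. exact (proj2 (He y Hy)).
Qed.

Lemma ccont_const (c : C) (x : R) : ccont (fun _ => c) x.
Proof. apply ccont_pair; apply continuous_const. Qed.

Lemma ccont_plus (f g : R -> C) (x : R) :
  ccont f x -> ccont g x -> ccont (fun t => f t + g t)%C x.
Proof.
  intros Hf Hg. apply ccont_pair; unfold Cplus; simpl.
  - apply (continuous_plus (fun t => Re (f t)) (fun t => Re (g t))); apply ccont_Re; assumption.
  - apply (continuous_plus (fun t => Im (f t)) (fun t => Im (g t))); apply ccont_Im; assumption.
Qed.

Lemma ccont_mult (f g : R -> C) (x : R) :
  ccont f x -> ccont g x -> ccont (fun t => f t * g t)%C x.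
Proof.
  intros Hf Hg.
  pose proof (ccont_Re _ _ Hf); pose proof (ccont_Im _ _ Hf).
  pose proof (ccont_Re _ _ Hg); pose proof (ccont_Im _ _ Hg).
  apply ccont_pair; simpl.
  - apply (continuous_minus (fun t => Re (f t) * Re (g t)) (fun t => Im (f t) * Im (g t)));
      apply (continuous_mult (K := R_AbsRing)); assumption.
  - apply (continuous_plus (fun t => Re (f t) * Im (g t)) (fun t => Im (f t) * Re (g t)));
      apply (continuous_mult (K := R_AbsRing)); assumption.
Qed.

Lemma continuous_Cmod (f : R -> C) (x : R) :
  ccont f x -> continuous (fun t => Cmod (f t)) x.
Proof.
  intros H.
  apply continuous_ext with (f := fun t => norm (V := C_R_NormedModule) (f t)).
  { intros t. symmetry. apply Cmod_norm. }
  exact (continuous_comp (V := C_R_NormedModule) f norm x H (filterlim_norm (V := C_R_NormedModule) (f x))).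
Qed.

Lemma ccont_eps (f : R -> C) (x : R) : ccont f x ->
  forall e, 0 < e -> exists d, 0 < d /\ forall y, Rabs (y - x) < d -> Cmod (f y - f x) < e.
Proof.
  intros H e He.
  destruct (continuous_Cmod (fun t => f t - f x)%C x
    (ccont_plus f (fun _ => (- f x)%C) x H (ccont_const _ _)) _ (locally_ball _ (mkposreal e He))) as [d Hd].
  exists d. split; [apply d|]. intros y Hy. specialize (Hd y Hy).
  unfold ball in Hd; simpl in Hd; unfold AbsRing_ball, abs, minus, plus, opp in Hd; simpl in Hd.
  replace (f x - f x)%C with (RtoC 0) in Hd by ring. rewrite Cmod_0 in Hd.
  apply Rabs_lt_between in Hd. assert (T : Cmod (f y - f x) + - 0 < e) by exact (proj2 Hd). lra.
Qed.

Lemma eps_ccont (f : R -> C) (x : R) :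
  (forall e, 0 < e -> exists d, 0 < d /\ forall y, Rabs (y - x) < d -> Cmod (f y - f x) < e) ->
  ccont f x.
Proof.
  intros H P [e He].
  destruct (H e (cond_pos e)) as [d [Hd Hd']].
  exists (mkposreal d Hd). intros y Hy. apply He.
  apply C_NormedModule_mixin_compat1. exact (Hd' y Hy).
Qed.

Lemma cdiff_continuous (k : C -> C) (p : C) : cdiff k p ->
  forall e, 0 < e -> exists d, 0 < d /\ forall w, Cmod (w - p) < d -> Cmod (k w - k p) < e.
Proof.
  intros [c Hc] e He.
  destruct (Hc 1 Rlt_0_1) as [d [Hd Hd']].
  pose proof (Cmod_ge_0 c) as Hc0.
  exists (Rmin d (e / (2 + Cmod c))). split.
  { apply Rmin_pos; [assumption|]. apply Rdiv_lt_0_compat; lra. }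
  intros w Hw.
  assert (Hw1 : Cmod (w - p) < d) by (eapply Rlt_le_trans; [exact Hw | apply Rmin_l]).
  assert (Hw2 : Cmod (w - p) < e / (2 + Cmod c)) by (eapply Rlt_le_trans; [exact Hw | apply Rmin_r]).
  specialize (Hd' w Hw1).
  replace (k w - k p)%C with ((k w - k p - c * (w - p)) + c * (w - p))%C by ring.
  eapply Rle_lt_trans; [apply Cmod_triangle|]. rewrite Cmod_mult.
  apply Rlt_div_r in Hw2; [|lra].
  pose proof (Cmod_ge_0 (w - p)). nra.
Qed.

Lemma ccont_comp (k : C -> C) (f : R -> C) (x : R) :
  cdiff k (f x) -> ccont f x -> ccont (fun t => k (f t)) x.
Proof.
  intros Hk Hf. apply eps_ccont. intros e He.
  destruct (cdiff_continuous _ _ Hk e He) as [d [Hd Hd']].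
  destruct (ccont_eps _ _ Hf d Hd) as [d2 [Hd2 Hd2']].
  exists d2. split; auto.
Qed.

Lemma cdiff_ext (f g : C -> C) (p : C) : (forall w, f w = g w) -> cdiff f p -> cdiff g p.
Proof.
  intros H [d Hd]. exists d. intros eta He. destruct (Hd eta He) as [e [H1 H2]].
  exists e. split; [assumption|]. intros w Hw. rewrite <- !H. auto.
Qed.

Lemma cdiff_const (c p : C) : cdiff (fun _ => c) p.
Proof.
  exists 0%C. intros eta He. exists 1. split; [lra|]. intros w _.
  replace (c - c - 0 * (w - p))%C with (RtoC 0) by ring. rewrite Cmod_0.
  pose proof (Cmod_ge_0 (w - p)). nra.
Qed.

Lemma cdiff_id (p : C) : cdiff (fun w => w) p.
Proof.
  exists 1%C. intros eta He. exists 1. split; [lra|]. intros w _.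
  replace (w - p - 1 * (w - p))%C with (RtoC 0) by ring. rewrite Cmod_0.
  pose proof (Cmod_ge_0 (w - p)). nra.
Qed.

Lemma cdiff_plus (f g : C -> C) (p : C) :
  cdiff f p -> cdiff g p -> cdiff (fun w => f w + g w)%C p.
Proof.
  intros [a Ha] [b Hb]. exists (a + b)%C. intros eta He.
  destruct (Ha (eta / 2)) as [d1 [Hd1 H1]]; [lra|].
  destruct (Hb (eta / 2)) as [d2 [Hd2 H2]]; [lra|].
  exists (Rmin d1 d2). split; [apply Rmin_pos; assumption|]. intros w Hw.
  specialize (H1 w (Rlt_le_trans _ _ _ Hw (Rmin_l _ _))).
  specialize (H2 w (Rlt_le_trans _ _ _ Hw (Rmin_r _ _))).
  replace (f w + g w - (f p + g p) - (a + b) * (w - p))%C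
    with ((f w - f p - a * (w - p)) + (g w - g p - b * (w - p)))%C by ring.
  eapply Rle_trans; [apply Cmod_triangle|]. lra.
Qed.

Lemma cdiff_mult (f g : C -> C) (p : C) :
  cdiff f p -> cdiff g p -> cdiff (fun w => f w * g w)%C p.
Proof.
  intros Hf Hg.
  pose proof (cdiff_continuous _ _ Hg) as Cg.
  destruct Hf as [a Ha], Hg as [b Hb]. exists (a * g p + f p * b)%C. intros eta He.
  pose proof (Cmod_ge_0 a) as Na. pose proof (Cmod_ge_0 (f p)) as Nf. pose proof (Cmod_ge_0 (g p)) as Ng.
  (* The remainder of the product splits into four pieces, at most q |w - p| times 1, |g p|, |f p|
     and |a|; [K] exceeds the sum of these factors. *)
  set (K := 3 + Cmod a + Cmod (f p) + Cmod (g p)).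
  assert (HK : 0 < K) by (unfold K; lra).
  assert (Hek : 0 < eta / K) by (apply Rdiv_lt_0_compat; lra).
  destruct (Ha _ Hek) as [d1 [Hd1 H1]].
  destruct (Hb _ Hek) as [d2 [Hd2 H2]].
  destruct (Cg (Rmin 1 (eta / K))) as [d3 [Hd3 H3]]; [apply Rmin_pos; lra|].
  exists (Rmin d1 (Rmin d2 d3)). split; [repeat apply Rmin_pos; assumption|]. intros w Hw.
  pose proof (Rmin_l d1 (Rmin d2 d3)). pose proof (Rmin_r d1 (Rmin d2 d3)).
  pose proof (Rmin_l d2 d3). pose proof (Rmin_r d2 d3).
  specialize (H1 w ltac:(lra)). specialize (H2 w ltac:(lra)). specialize (H3 w ltac:(lra)).
  pose proof (Rmin_l 1 (eta / K)). pose proof (Rmin_r 1 (eta / K)).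
  replace (f w * g w - f p * g p - (a * g p + f p * b) * (w - p))%C
    with ((f w - f p - a * (w - p)) * (g w - g p) + (f w - f p - a * (w - p)) * g p
          + f p * (g w - g p - b * (w - p)) + a * (w - p) * (g w - g p))%C by ring.
  eapply Rle_trans; [apply Cmod_triangle|].
  eapply Rle_trans; [apply Rplus_le_compat_r, Cmod_triangle|].
  eapply Rle_trans; [apply Rplus_le_compat_r, Rplus_le_compat_r, Cmod_triangle|].
  rewrite !Cmod_mult.
  assert (E : eta = eta / K * K) by (field; lra).
  set (q := eta / K) in *. set (x := Cmod (w - p)) in *.
  set (u := Cmod (f w - f p - a * (w - p))) in *.
  set (v := Cmod (g w - g p - b * (w - p))) in *.
  set (y := Cmod (g w - g p)) in *.
  assert (0 <= x) by apply Cmod_ge_0. assert (0 <= u) by apply Cmod_ge_0.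
  assert (0 <= y) by apply Cmod_ge_0. assert (0 <= v) by apply Cmod_ge_0.
  rewrite E. unfold K.
  assert (u * y <= q * x) by nra.
  assert (u * Cmod (g p) <= q * x * Cmod (g p)) by (apply Rmult_le_compat_r; lra).
  assert (Cmod (f p) * v <= q * x * Cmod (f p))
    by (rewrite (Rmult_comm _ (Cmod (f p))); apply Rmult_le_compat_l; lra).
  assert (Cmod a * x * y <= Cmod a * x * q) by (apply Rmult_le_compat_l; [apply Rmult_le_pos|]; lra).
  assert (0 <= q * x) by (apply Rmult_le_pos; lra).
  nra.
Qed.

Lemma cdiff_sub_const (c p : C) : cdiff (fun w => w - c)%C p.
Proof. apply cdiff_plus; [apply cdiff_id | apply cdiff_const]. Qed.

Lemma cdiff_inv (f : C -> C) (p : C) :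
  f p <> 0%C -> cdiff f p -> cdiff (fun w => / f w)%C p.
Proof.
  intros Hp Hf.
  pose proof (cdiff_continuous _ _ Hf) as Cf.
  destruct Hf as [a Ha]. exists (- (a / (f p * f p)))%C. intros eta He.
  apply Cmod_gt_0 in Hp as Hp'. set (m := Cmod (f p)) in *.
  pose proof (Cmod_ge_0 a).
  (* Near p the denominator |f w * f p| is at least m^2 / 2, and the numerator will be at most q (1
     + |a| / m) |w - p|; this q makes the quotient at most eta |w - p|. *)
  set (q := eta * m * m / (2 * (1 + Cmod a / m))).
  assert (Hden : 0 < 1 + Cmod a / m).
  { assert (0 <= Cmod a / m) by (apply Rmult_le_pos; [lra | left; apply Rinv_0_lt_compat; lra]). lra. }
  assert (Hq : 0 < q). { unfold q. apply Rdiv_lt_0_compat; [|lra]. repeat apply Rmult_lt_0_compat; lra. }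
  assert (Hq2 : 0 < q * m) by (apply Rmult_lt_0_compat; lra).
  destruct (Ha _ Hq) as [d1 [Hd1 H1]].
  destruct (Cf (Rmin (m / 2) (q))) as [d2 [Hd2 H2]]; [apply Rmin_pos; lra|].
  exists (Rmin d1 d2). split; [apply Rmin_pos; assumption|]. intros w Hw.
  specialize (H1 w (Rlt_le_trans _ _ _ Hw (Rmin_l _ _))).
  specialize (H2 w (Rlt_le_trans _ _ _ Hw (Rmin_r _ _))).
  pose proof (Rmin_l (m / 2) q). pose proof (Rmin_r (m / 2) q).
  assert (Hfw : m / 2 <= Cmod (f w)).
  { assert (m <= Cmod (f w) + Cmod (f w - f p)).
    { unfold m. replace (f p) with (f w + - (f w - f p))%C at 1 by ring.
      eapply Rle_trans; [apply Cmod_triangle|]. rewrite Cmod_opp. lra. }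
    lra. }
  assert (Hfw0 : f w <> 0%C) by (apply Cmod_gt_0; lra).
  replace (/ f w - / f p - - (a / (f p * f p)) * (w - p))%C
    with (- ((f w - f p - a * (w - p)) + (a * (w - p) / f p) * - (f w - f p)) / (f w * f p))%C
    by (field; split; assumption).
  rewrite Cmod_div by (apply Cmult_neq_0; assumption).
  rewrite Cmod_opp. rewrite Cmod_mult. fold m.
  assert (Hnum : Cmod (f w - f p - a * (w - p) + a * (w - p) / f p * - (f w - f p))
                 <= eta * Cmod (w - p) * (m * m / 2)).
  { eapply Rle_trans; [apply Cmod_triangle|].
    rewrite Cmod_mult, Cmod_opp, Cmod_div, Cmod_mult by assumption. fold m.
    pose proof (Cmod_ge_0 (w - p)) as Hx.
    replace (eta * Cmod (w - p) * (m * m / 2)) with (q * (1 + Cmod a / m) * Cmod (w - p))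
      by (unfold q; field; split; [lra | ]; apply Rgt_not_eq; nra).
    assert (Cmod a * Cmod (w - p) / m * Cmod (f w - f p) <= Cmod a * Cmod (w - p) / m * q).
    { apply Rmult_le_compat_l; [|lra]. apply Rmult_le_pos; [apply Rmult_le_pos; lra|].
      left; apply Rinv_0_lt_compat; lra. }
    replace (q * (1 + Cmod a / m) * Cmod (w - p))
      with (q * Cmod (w - p) + Cmod a * Cmod (w - p) / m * q) by (field; lra).
    lra. }
  apply Rle_div_l; [apply Rmult_lt_0_compat; lra|].
  eapply Rle_trans; [exact Hnum|].
  apply Rmult_le_compat_l; [apply Rmult_le_pos; [lra | apply Cmod_ge_0]|]. nra.
Qed.

Lemma ex_derive_cdiff (k : C -> C) (p : C) :
  @ex_derive C_AbsRing C_NormedModule k p -> cdiff k p.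
Proof.
  intros [d Hd]. exists d. intros eta He.
  destruct Hd as [_ Hd].
  destruct (Hd p (fun P HP => HP) (mkposreal eta He)) as [del Hdel].
  exists del. split; [apply del|]. intros w Hw.
  specialize (Hdel w Hw). simpl in Hdel.
  unfold minus, plus, opp, scal, norm in Hdel; simpl in Hdel.
  unfold mult in Hdel; simpl in Hdel.
  replace (k w - k p - d * (w - p))%C with (k w + - k p + - ((w + - p) * d))%C by (unfold Cminus; ring).
  exact Hdel.
Qed.

(** * Integrals of complex functions of a real variable *)

Lemma is_CInt_pair (f : R -> C) (a b : R) (l : C) :
  is_RInt (fun t => Re (f t)) a b (Re l) -> is_RInt (fun t => Im (f t)) a b (Im l) ->
  is_CInt f a b l.
Proof.
  intros H1 H2. destruct l as [l1 l2].
  exact (is_RInt_fct_extend_pair (U := R_NormedModule) (V := R_NormedModule) f a b l1 l2 H1 H2).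
Qed.

Lemma is_RInt_const_unit (x : R) : is_RInt (fun _ => x) 0 1 x.
Proof.
  assert (H := is_RInt_const (V := R_NormedModule) 0 1 x).
  refine (eq_ind _ (fun l => is_RInt (fun _ => x) 0 1 l) H x _).
  unfold scal; simpl; unfold mult; simpl; ring.
Qed.

Lemma is_CInt_const (c : C) : is_CInt (fun _ => c) 0 1 c.
Proof. apply is_CInt_pair; apply is_RInt_const_unit. Qed.

Lemma is_CInt_Re (f : R -> C) (a b : R) (l : C) :
  is_CInt f a b l -> is_RInt (fun t => Re (f t)) a b (Re l).
Proof.
  exact (is_RInt_fct_extend_fst (U := R_NormedModule) (V := R_NormedModule) f a b l).
Qed.

Lemma is_CInt_Im (f : R -> C) (a b : R) (l : C) :
  is_CInt f a b l -> is_RInt (fun t => Im (f t)) a b (Im l).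
Proof.
  exact (is_RInt_fct_extend_snd (U := R_NormedModule) (V := R_NormedModule) f a b l).
Qed.

Lemma is_CInt_unique (f : R -> C) (a b : R) (l1 l2 : C) :
  is_CInt f a b l1 -> is_CInt f a b l2 -> l1 = l2.
Proof.
  intros H1 H2.
  rewrite <- (is_RInt_unique (V := C_R_CompleteNormedModule) _ _ _ _ H1).
  exact (is_RInt_unique (V := C_R_CompleteNormedModule) _ _ _ _ H2).
Qed.

Lemma is_CInt_plus (f g : R -> C) (a b : R) (l m : C) :
  is_CInt f a b l -> is_CInt g a b m -> is_CInt (fun t => f t + g t)%C a b (l + m)%C.
Proof. exact (is_RInt_plus (V := C_R_NormedModule) f g a b l m). Qed.

(** Integrals live in [C] as a real normed space, whose scalars are real; a complex factor therefore
    has to pass through the components. *)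
Lemma is_CInt_scal (c : C) (f : R -> C) (a b : R) (l : C) :
  is_CInt f a b l -> is_CInt (fun t => c * f t)%C a b (c * l)%C.
Proof.
  intros H. pose proof (is_CInt_Re _ _ _ _ H) as H1. pose proof (is_CInt_Im _ _ _ _ H) as H2.
  apply is_CInt_pair; simpl.
  - apply (is_RInt_minus (V := R_NormedModule)); apply (is_RInt_scal (V := R_NormedModule)); assumption.
  - apply (is_RInt_plus (V := R_NormedModule)); apply (is_RInt_scal (V := R_NormedModule)); assumption.
Qed.

Lemma is_CInt_minus (f g : R -> C) (a b : R) (l m : C) :
  is_CInt f a b l -> is_CInt g a b m -> is_CInt (fun t => f t - g t)%C a b (l - m)%C.
Proof. exact (is_RInt_minus (V := C_R_NormedModule) f g a b l m). Qed.

Lemma is_CInt_ext (f g : R -> C) (a b : R) (l : C) :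
  a <= b -> (forall t, a <= t <= b -> f t = g t) -> is_CInt f a b l -> is_CInt g a b l.
Proof.
  intros Hab H. apply (is_RInt_ext (V := C_R_NormedModule)).
  rewrite Rmin_left, Rmax_right by assumption. intros x Hx. apply H. lra.
Qed.

Lemma is_CInt_Chasles (f : R -> C) (a b c : R) (l m : C) :
  is_CInt f a b l -> is_CInt f b c m -> is_CInt f a c (l + m)%C.
Proof. exact (is_RInt_Chasles (V := C_R_NormedModule) f a b c l m). Qed.

Definition CInt (f : R -> C) (a b : R) : C := @RInt C_R_CompleteNormedModule f a b.

Lemma CInt_ext (f g : R -> C) (a b : R) : (forall t, f t = g t) -> CInt f a b = CInt g a b.
Proof. intros H. apply (RInt_ext (V := C_R_CompleteNormedModule)). intros; apply H. Qed.

Lemma CInt_eq (f : R -> C) (a b : R) (l : C) : is_CInt f a b l -> CInt f a b = l.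
Proof. apply (is_RInt_unique (V := C_R_CompleteNormedModule)). Qed.

Lemma CInt_correct (f : R -> C) (a b : R) :
  a <= b -> (forall t, a <= t <= b -> ccont f t) -> is_CInt f a b (CInt f a b).
Proof.
  intros Hab H. apply (RInt_correct (V := C_R_CompleteNormedModule)).
  apply (ex_RInt_continuous (V := C_R_CompleteNormedModule)).
  rewrite Rmin_left, Rmax_right by assumption. exact H.
Qed.

Lemma CInt_Chasles (f : R -> C) (a b c : R) :
  a <= b -> b <= c -> (forall t, a <= t <= c -> ccont f t) ->
  (CInt f a c = CInt f a b + CInt f b c)%C.
Proof.
  intros Hab Hbc H.
  apply (is_CInt_unique f a c).
  - apply CInt_correct; [lra | assumption].
  - apply is_CInt_Chasles with b; apply CInt_correct; auto; intros t Ht; apply H; lra.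
Qed.

Lemma is_CInt_FTC (f df : R -> C) (a b : R) :
  (forall t, cderiv f t (df t)) -> (forall t, ccont df t) ->
  is_CInt df a b (f b - f a)%C.
Proof.
  intros H1 H2. apply is_CInt_pair; simpl.
  - apply (is_RInt_derive (fun t => Re (f t)) (fun t => Re (df t))); intros x _;
      [apply H1 | apply ccont_Re, H2].
  - apply (is_RInt_derive (fun t => Im (f t)) (fun t => Im (df t))); intros x _;
      [apply H1 | apply ccont_Im, H2].
Qed.

Lemma Cmod_CInt_le (f : R -> C) (g : R -> R) (a b : R) (l : C) (m : R) :
  a <= b -> (forall t, a <= t <= b -> Cmod (f t) <= g t) ->
  is_CInt f a b l -> is_RInt g a b m -> Cmod l <= m.
Proof.
  intros Hab H. rewrite Cmod_norm. apply (norm_RInt_le (V := C_R_NormedModule)); [assumption|].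
  intros x Hx. specialize (H x Hx). rewrite Cmod_norm in H. exact H.
Qed.

Lemma Cmod_CInt_le_const (f : R -> C) (a b : R) (l : C) (M : R) :
  a <= b -> (forall t, a <= t <= b -> Cmod (f t) <= M) ->
  is_CInt f a b l -> Cmod l <= (b - a) * M.
Proof.
  intros Hab H Hl. apply (Cmod_CInt_le f (fun _ => M) a b l); try assumption.
  apply (is_RInt_const (V := R_NormedModule) a b M).
Qed.

Lemma cderiv_ccont (f : R -> C) (t : R) (l : C) : cderiv f t l -> ccont f t.
Proof.
  intros [H1 H2]. apply ccont_pair; apply (ex_derive_continuous (V := R_NormedModule)); eexists; eassumption.
Qed.

Lemma cderiv_eq (f : R -> C) (t : R) (l m : C) : cderiv f t l -> l = m -> cderiv f t m.
Proof. intros H <-; exact H. Qed.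

Lemma cderiv_const (c : C) (t : R) : cderiv (fun _ => c) t 0%C.
Proof. split; apply (is_derive_const (V := R_NormedModule)). Qed.

Lemma cderiv_plus (f g : R -> C) (t : R) (l m : C) :
  cderiv f t l -> cderiv g t m -> cderiv (fun u => f u + g u)%C t (l + m)%C.
Proof.
  intros [H1 H2] [H3 H4]; split; simpl; apply (is_derive_plus (V := R_NormedModule)); assumption.
Qed.


Lemma is_derive_Rmult (f g : R -> R) (t l m : R) :
  is_derive f t l -> is_derive g t m -> is_derive (fun u => f u * g u) t (l * g t + f t * m).
Proof. intros H1 H2. apply (is_derive_mult f g t l m H1 H2). intros; apply Rmult_comm. Qed.

Lemma cderiv_mult (f g : R -> C) (t : R) (l m : C) :
  cderiv f t l -> cderiv g t m -> cderiv (fun u => f u * g u)%C t (l * g t + f t * m)%C.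
Proof.
  intros [H1 H2] [H3 H4]; split; simpl.
  - eapply (is_derive_ext (V := R_NormedModule) (fun u => Re (f u) * Re (g u) - Im (f u) * Im (g u))).
    { reflexivity. }
    replace (fst l * fst (g t) - snd l * snd (g t) + (fst (f t) * fst m - snd (f t) * snd m))
      with ((Re l * Re (g t) + Re (f t) * Re m) - (Im l * Im (g t) + Im (f t) * Im m)) by (unfold Re, Im; ring).
    apply (is_derive_minus (V := R_NormedModule)); apply is_derive_Rmult; assumption.
  - eapply (is_derive_ext (V := R_NormedModule) (fun u => Re (f u) * Im (g u) + Im (f u) * Re (g u))).
    { reflexivity. }
    replace (fst l * snd (g t) + snd l * fst (g t) + (fst (f t) * snd m + snd (f t) * fst m))
      with ((Re l * Im (g t) + Re (f t) * Im m) + (Im l * Re (g t) + Im (f t) * Re m)) by (unfold Re, Im; ring).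
    apply (is_derive_plus (V := R_NormedModule)); apply is_derive_Rmult; assumption.
Qed.

(** * Goursat's lemma *)

(** Goursat's nested squares, separated from complex integration. If F is c > 0 on the unit square,
    some quarter at each stage keeps F >= c h^2, where h is its side. The chosen squares close in on
    one point, where the local bound with a small eta is violated. *)
Lemma square_bisection (F : R -> R -> R -> R) :
  (forall x y h, 0 <= x -> 0 <= y -> 0 < h -> x + h <= 1 -> y + h <= 1 ->
     F x y h <= F x y (h / 2) + F (x + h / 2) y (h / 2)
                + F x (y + h / 2) (h / 2) + F (x + h / 2) (y + h / 2) (h / 2)) ->
  (forall x0 y0, 0 <= x0 <= 1 -> 0 <= y0 <= 1 -> forall eta, 0 < eta ->
     exists delta, 0 < delta /\ forall x y h, 0 < h < delta ->
       0 <= x -> 0 <= y -> x + h <= 1 -> y + h <= 1 ->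
       x <= x0 <= x + h -> y <= y0 <= y + h -> F x y h <= eta * (h * h)) ->
  F 0 0 1 <= 0.
Proof.
  intros Hsub Hloc. destruct (Rle_or_lt (F 0 0 1) 0) as [|Hc]; [assumption|exfalso].
  set (c := F 0 0 1) in *.
  (* Three quarters are tested in turn; if all fail, subadditivity forces the fourth to satisfy the
     bound, so it is taken untested. *)
  set (next := fun (h : R) (p : R * R) =>
    if Rle_dec (c * (h * h)) (F (fst p) (snd p) h) then p
    else if Rle_dec (c * (h * h)) (F (fst p + h) (snd p) h) then (fst p + h, snd p)
    else if Rle_dec (c * (h * h)) (F (fst p) (snd p + h) h) then (fst p, snd p + h)
    else (fst p + h, snd p + h)).
  set (s := fix s (n : nat) : R * R :=
    match n with O => (0, 0) | S m => next ((/ 2) ^ S m) (s m) end).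
  assert (Hpos : forall n, 0 < (/ 2) ^ n) by (intros; apply pow_lt; lra).
  assert (Hnext : forall h p, 0 < h -> 0 <= fst p -> 0 <= snd p ->
    fst p + 2 * h <= 1 -> snd p + 2 * h <= 1 ->
    c * (2 * h * (2 * h)) <= F (fst p) (snd p) (2 * h) ->
    c * (h * h) <= F (fst (next h p)) (snd (next h p)) h /\
    fst p <= fst (next h p) <= fst p + h /\ snd p <= snd (next h p) <= snd p + h).
  { intros h [x y] Hh Hx Hy Hx1 Hy1 HF. simpl in *.
    specialize (Hsub x y (2 * h) Hx Hy ltac:(lra) Hx1 Hy1).
    replace (2 * h / 2) with h in Hsub by field.
    unfold next; simpl.
    repeat (destruct Rle_dec; simpl; [lra|]). lra. }
  assert (Hs : forall n, 0 <= fst (s n) /\ 0 <= snd (s n) /\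
     fst (s n) + (/ 2) ^ n <= 1 /\ snd (s n) + (/ 2) ^ n <= 1 /\
     c * ((/ 2) ^ n * (/ 2) ^ n) <= F (fst (s n)) (snd (s n)) ((/ 2) ^ n)).
  { induction n as [|n IH]; [simpl; fold c; lra|].
    destruct IH as (H1 & H2 & H3 & H4 & H5).
    assert (E : (/ 2) ^ n = 2 * (/ 2) ^ S n) by (simpl; field).
    rewrite E in H3, H4, H5.
    destruct (Hnext ((/ 2) ^ S n) (s n) (Hpos _) H1 H2 H3 H4 H5) as (A1 & A2 & A3).
    change (s (S n)) with (next ((/ 2) ^ S n) (s n)).
    repeat split; lra. }
  assert (Hstep : forall n, fst (s n) <= fst (s (S n)) /\ snd (s n) <= snd (s (S n)) /\
     fst (s (S n)) + (/ 2) ^ S n <= fst (s n) + (/ 2) ^ n /\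
     snd (s (S n)) + (/ 2) ^ S n <= snd (s n) + (/ 2) ^ n).
  { intros n. destruct (Hs n) as (H1 & H2 & H3 & H4 & H5).
    assert (E : (/ 2) ^ n = 2 * (/ 2) ^ S n) by (simpl; field).
    rewrite E in H3, H4, H5.
    destruct (Hnext ((/ 2) ^ S n) (s n) (Hpos _) H1 H2 H3 H4 H5) as (A1 & A2 & A3).
    change (s (S n)) with (next ((/ 2) ^ S n) (s n)).
    rewrite E. repeat split; lra. }
  (* Lower ends increase and upper ends decrease, so the limit of the lower ends lies in every
     interval. *)
  assert (Hlim : forall u : nat -> R,
    (forall n, u n <= u (S n)) -> (forall n, u (S n) + (/ 2) ^ S n <= u n + (/ 2) ^ n) ->
    exists l, forall n, u n <= l <= u n + (/ 2) ^ n).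
  { intros u Hinc Hdec.
    assert (Hd : forall n k, u (n + k)%nat + (/ 2) ^ (n + k) <= u n + (/ 2) ^ n).
    { intros n k; induction k as [|k IH]; [rewrite Nat.add_0_r; lra|].
      rewrite Nat.add_succ_r. specialize (Hdec (n + k)%nat). lra. }
    destruct (ex_finite_lim_seq_incr u (u 0%nat + 1) Hinc) as [l Hl].
    { intros n. specialize (Hd 0%nat n). specialize (Hpos n). simpl in Hd, Hpos. lra. }
    exists l. intros n. split.
    - apply (is_lim_seq_incr_compare u l Hl Hinc).
    - apply is_lim_seq_incr_n with (N := n) in Hl.
      apply (is_lim_seq_le (fun k => u (k + n)%nat) (fun _ => u n + (/ 2) ^ n) l (u n + (/ 2) ^ n));
        [|exact Hl|apply is_lim_seq_const].
      intros k. specialize (Hd n k). rewrite Nat.add_comm. specialize (Hpos (n + k)%nat). lra. }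
  destruct (Hlim (fun n => fst (s n))) as [x0 Hx0]; [apply Hstep | apply Hstep |].
  destruct (Hlim (fun n => snd (s n))) as [y0 Hy0]; [apply Hstep | apply Hstep |].
  (* With eta = c / 2 a small square would satisfy c h^2 <= F <= (c / 2) h^2, which is absurd. *)
  destruct (Hloc x0 y0) with (eta := c / 2) as [delta [Hdel HF]].
  { specialize (Hx0 0%nat). simpl in Hx0. lra. }
  { specialize (Hy0 0%nat). simpl in Hy0. lra. }
  { lra. }
  destruct (pow_lt_1_zero (/ 2)) with (y := delta) as [N HN]; [rewrite Rabs_pos_eq; lra | assumption |].
  specialize (HN N (le_n _)). rewrite Rabs_pos_eq in HN by (left; apply Hpos).
  destruct (Hs N) as (H1 & H2 & H3 & H4 & H5).
  specialize (HF (fst (s N)) (snd (s N)) ((/ 2) ^ N) (conj (Hpos N) HN) H1 H2 H3 H4 (Hx0 N) (Hy0 N)).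
  specialize (Hpos N).
  assert (0 < (/ 2) ^ N * (/ 2) ^ N) by (apply Rmult_lt_0_compat; assumption).
  nra.
Qed.

Definition curve_int (k : C -> C) (c dc : R -> C) (a b : R) : C :=
  CInt (fun t => k (c t) * dc t)%C a b.

Lemma cderiv_affine_primitive (c : R -> C) (dc p al be : C) (t : R) :
  cderiv c t dc ->
  cderiv (fun u => al * (c u - p) + be * ((c u - p) * (c u - p)) * / 2)%C t
         ((al + be * (c t - p)) * dc)%C.
Proof.
  intros H.
  assert (Hcp : cderiv (fun u => c u - p)%C t dc).
  { eapply cderiv_eq; [apply (cderiv_plus c (fun _ => (- p)%C)); [exact H | apply cderiv_const]|ring]. }
  eapply cderiv_eq.
  - apply cderiv_plus.
    + apply cderiv_mult; [apply cderiv_const | exact Hcp].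
    + apply cderiv_mult; [|apply cderiv_const]. apply cderiv_mult; [apply cderiv_const|].
      apply cderiv_mult; exact Hcp.
  - simpl. field.
Qed.

(** The affine part [al + be * (w - p)] of k has the primitive [A], so along the curve it
    contributes only endpoint values. What is left is the first-order remainder, at most eta D,
    against a speed of at most M. *)
Lemma curve_int_local (k : C -> C) (c dc : R -> C) (a b M D eta : R) (p al be : C) :
  a <= b ->
  (forall t, cderiv c t (dc t)) -> (forall t, ccont dc t) ->
  (forall t, a <= t <= b -> cdiff k (c t)) ->
  (forall t, a <= t <= b -> Cmod (dc t) <= M) ->
  (forall t, a <= t <= b -> Cmod (c t - p) <= D) ->
  0 <= eta ->
  (forall t, a <= t <= b ->
     Cmod (k (c t) - al - be * (c t - p)) <= eta * Cmod (c t - p)) ->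
  let A := fun w => (al * (w - p) + be * ((w - p) * (w - p)) * / 2)%C in
  Cmod (curve_int k c dc a b - (A (c b) - A (c a))) <= (b - a) * (eta * D * M).
Proof.
  intros Hab Hc Hdc Hk HM HD Heta Hr A.
  assert (Hcc : forall t, ccont c t) by (intros t; eapply cderiv_ccont, Hc).
  apply (Cmod_CInt_le_const (fun t => k (c t) * dc t - (al + be * (c t - p)) * dc t)%C); [assumption| |].
  - intros t Ht. replace (k (c t) * dc t - (al + be * (c t - p)) * dc t)%C
      with ((k (c t) - al - be * (c t - p)) * dc t)%C by ring.
    rewrite Cmod_mult. specialize (Hr t Ht). specialize (HM t Ht). specialize (HD t Ht).
    pose proof (Cmod_ge_0 (c t - p)).
    apply Rmult_le_compat; try apply Cmod_ge_0; [|assumption].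
    eapply Rle_trans; [exact Hr|]. apply Rmult_le_compat_l; assumption.
  - apply is_CInt_minus.
    + apply CInt_correct; [assumption|]. intros t Ht.
      apply ccont_mult; [|apply Hdc]. apply ccont_comp; auto.
    + apply (is_CInt_FTC (fun t => A (c t))).
      * intros t. apply cderiv_affine_primitive, Hc.
      * intros t. apply ccont_mult; [|apply Hdc].
        apply ccont_plus; [apply ccont_const|]. apply ccont_mult; [apply ccont_const|].
        apply ccont_plus; [apply Hcc | apply ccont_const].
Qed.

Definition square_int (k : C -> C) (g gx gy : R -> R -> C) (x y h : R) : C :=
  (curve_int k (fun u => g u y) (fun u => gx u y) x (x + h)%R
   + curve_int k (g (x + h)%R) (gy (x + h)%R) y (y + h)%R
   - curve_int k (fun u => g u (y + h)%R) (fun u => gx u (y + h)%R) x (x + h)%R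
   - curve_int k (g x) (gy x) y (y + h)%R)%C.

(** The bisection takes place in the parameter square, not in the plane: [g] may be any map with
    bounded partial derivatives, injective or not. Since it is Lipschitz, a parameter square of side
    h has an image of size O(h), and the boundary integral over it is o(h^2) near each point. *)
Lemma Goursat (k : C -> C) (g gx gy : R -> R -> C) (M : R) :
  (forall x y, cderiv (fun u => g u y) x (gx x y)) ->
  (forall x y, cderiv (g x) y (gy x y)) ->
  (forall x y, ccont (fun u => gx u y) x) ->
  (forall x y, ccont (gy x) y) ->
  (forall x y, 0 <= x <= 1 -> 0 <= y <= 1 -> Cmod (gx x y) <= M) ->
  (forall x y, 0 <= x <= 1 -> 0 <= y <= 1 -> Cmod (gy x y) <= M) ->
  (forall x y, 0 <= x <= 1 -> 0 <= y <= 1 -> cdiff k (g x y)) ->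
  square_int k g gx gy 0 0 1 = 0%C.
Proof.
  intros Hgx Hgy Cx Cy Mx My Hk.
  apply Cmod_eq_0. apply Rle_antisym; [|apply Cmod_ge_0].
  assert (HM : 0 <= M).
  { eapply Rle_trans; [apply Cmod_ge_0 | apply (Mx 0 0); lra]. }
  assert (Kx : forall x y, 0 <= x <= 1 -> 0 <= y <= 1 -> ccont (fun u => k (g u y) * gx u y)%C x).
  { intros x y H1 H2. apply ccont_mult; [|apply Cx]. apply (ccont_comp k (fun u => g u y)); [apply Hk; assumption|].
    eapply cderiv_ccont, Hgx. }
  assert (Ky : forall x y, 0 <= x <= 1 -> 0 <= y <= 1 -> ccont (fun v => k (g x v) * gy x v)%C y).
  { intros x y H1 H2. apply ccont_mult; [|apply Cy]. apply (ccont_comp k (g x)); [apply Hk; assumption|].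
    eapply cderiv_ccont, Hgy. }
  assert (Lip : forall x y x' y', 0 <= x <= x' -> x' <= 1 -> 0 <= y <= y' -> y' <= 1 ->
     Cmod (g x' y' - g x y) <= M * (x' - x) + M * (y' - y)).
  { intros x y x' y' Hx Hx' Hy Hy'.
    replace (g x' y' - g x y)%C with ((g x' y' - g x y') + (g x y' - g x y))%C by ring.
    eapply Rle_trans; [apply Cmod_triangle|]. rewrite !(Rmult_comm M). apply Rplus_le_compat.
    - apply (Cmod_CInt_le_const (fun u => gx u y')); [lra | intros t Ht; apply Mx; lra |].
      apply (is_CInt_FTC (fun u => g u y')); auto.
    - apply (Cmod_CInt_le_const (gy x)); [lra | intros t Ht; apply My; lra |].
      apply is_CInt_FTC; auto. }
  apply (square_bisection (fun x y h => Cmod (square_int k g gx gy x y h))).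
  - intros x y h Hx Hy Hh Hx1 Hy1.
    eapply Rle_trans; [|apply Rplus_le_compat_r, Rplus_le_compat_r, Cmod_triangle].
    eapply Rle_trans; [|apply Rplus_le_compat_r, Cmod_triangle].
    eapply Rle_trans; [|apply Cmod_triangle].
    (* Each inner edge is run through twice in opposite directions, so the four small boundary
       integrals add up to exactly the large one. *)
    right. f_equal. unfold square_int, curve_int.
    replace (x + h / 2 + h / 2) with (x + h) by field.
    replace (y + h / 2 + h / 2) with (y + h) by field.
    rewrite (CInt_Chasles _ x (x + h / 2) (x + h)) by (try lra; intros; apply Kx; lra).
    rewrite (CInt_Chasles (fun t => (k (g t (y + h)%R) * gx t (y + h)%R)%C) x (x + h / 2) (x + h))
      by (try lra; intros; apply Kx; lra).
    rewrite (CInt_Chasles _ y (y + h / 2) (y + h)) by (try lra; intros; apply Ky; lra).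
    rewrite (CInt_Chasles (fun t => (k (g x t) * gy x t)%C) y (y + h / 2) (y + h))
      by (try lra; intros; apply Ky; lra).
    ring.
  - intros x0 y0 Hx0 Hy0 eta Heta.
    destruct (Hk x0 y0 Hx0 Hy0) as [be Hbe].
    (* Each of the four sides will contribute h * q * (4 M h) * M, in total 16 q M^2 h^2 <= eta
       h^2. *)
    set (q := eta / (1 + 16 * M * M)).
    assert (HMM : 0 <= M * M) by (apply Rmult_le_pos; assumption).
    assert (Hq : 0 < q) by (apply Rdiv_lt_0_compat; lra).
    destruct (Hbe q Hq) as [d [Hd Hd']].
    (* Points of the image are within 4 M h of p: at most 2 M h to the corner g x y, and 2 M h from
       there to p. This choice of delta puts 4 M h below d. *)
    exists (d / (1 + 4 * M)). split; [apply Rdiv_lt_0_compat; lra|].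
    intros x y h [Hh Hhd] Hx Hy Hx1 Hy1 Hxx Hyy.
    set (p := g x0 y0) in *.
    assert (HD : forall u v, x <= u <= x + h -> y <= v <= y + h -> Cmod (g u v - p) <= 4 * M * h).
    { intros u v Hu Hv. unfold p.
      replace (g u v - g x0 y0)%C with ((g u v - g x y) + - (g x0 y0 - g x y))%C by ring.
      eapply Rle_trans; [apply Cmod_triangle|]. rewrite Cmod_opp.
      pose proof (Lip x y u v ltac:(lra) ltac:(lra) ltac:(lra) ltac:(lra)).
      pose proof (Lip x y x0 y0 ltac:(lra) ltac:(lra) ltac:(lra) ltac:(lra)).
      assert (M * (u - x) <= M * h) by (apply Rmult_le_compat_l; lra).
      assert (M * (v - y) <= M * h) by (apply Rmult_le_compat_l; lra).
      assert (M * (x0 - x) <= M * h) by (apply Rmult_le_compat_l; lra).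
      assert (M * (y0 - y) <= M * h) by (apply Rmult_le_compat_l; lra).
      lra. }
    apply Rlt_div_r in Hhd; [|lra].
    assert (HR : forall u v, x <= u <= x + h -> y <= v <= y + h ->
      Cmod (k (g u v) - k p - be * (g u v - p)) <= q * Cmod (g u v - p)).
    { intros u v Hu Hv. apply Hd'. eapply Rle_lt_trans; [apply (HD u v Hu Hv)|]. lra. }
    pose (A := fun w => (k p * (w - p) + be * ((w - p) * (w - p)) * / 2)%C).
    assert (B1 := curve_int_local k (fun u => g u y) (fun u => gx u y) x (x + h) M (4 * M * h) q p (k p) be
      ltac:(lra) (fun t => Hgx t y) (fun t => Cx t y) ltac:(intros; apply Hk; lra) ltac:(intros; apply Mx; lra)
      ltac:(intros; apply HD; lra) ltac:(lra) ltac:(intros; apply HR; lra)).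
    assert (B2 := curve_int_local k (g (x + h)) (gy (x + h)) y (y + h) M (4 * M * h) q p (k p) be
      ltac:(lra) (Hgy (x + h)) (Cy (x + h)) ltac:(intros; apply Hk; lra) ltac:(intros; apply My; lra)
      ltac:(intros; apply HD; lra) ltac:(lra) ltac:(intros; apply HR; lra)).
    assert (B3 := curve_int_local k (fun u => g u (y + h)) (fun u => gx u (y + h)) x (x + h) M (4 * M * h) q p (k p) be
      ltac:(lra) (fun t => Hgx t (y + h)) (fun t => Cx t (y + h)) ltac:(intros; apply Hk; lra) ltac:(intros; apply Mx; lra)
      ltac:(intros; apply HD; lra) ltac:(lra) ltac:(intros; apply HR; lra)).
    assert (B4 := curve_int_local k (g x) (gy x) y (y + h) M (4 * M * h) q p (k p) be
      ltac:(lra) (Hgy x) (Cy x) ltac:(intros; apply Hk; lra) ltac:(intros; apply My; lra)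
      ltac:(intros; apply HD; lra) ltac:(lra) ltac:(intros; apply HR; lra)).
    cbv zeta in B1, B2, B3, B4. unfold square_int.
    replace (x + h - x) with h in B1, B3 by ring.
    replace (y + h - y) with h in B2, B4 by ring.
    set (I1 := curve_int k (fun u => g u y) _ x (x + h)) in *.
    set (I2 := curve_int k (g (x + h)) _ y (y + h)) in *.
    set (I3 := curve_int k (fun u => g u (y + h)) _ x (x + h)) in *.
    set (I4 := curve_int k (g x) _ y (y + h)) in *.
    change (Cmod (I1 - (A (g (x + h)%R y) - A (g x y)))%C <= h * (q * (4 * M * h) * M)) in B1.
    change (Cmod (I2 - (A (g (x + h)%R (y + h)%R) - A (g (x + h)%R y)))%C <= h * (q * (4 * M * h) * M)) in B2.
    change (Cmod (I3 - (A (g (x + h)%R (y + h)%R) - A (g x (y + h)%R)))%C <= h * (q * (4 * M * h) * M)) in B3.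
    change (Cmod (I4 - (A (g x (y + h)%R) - A (g x y)))%C <= h * (q * (4 * M * h) * M)) in B4.
    (* The values of the primitive [A] at the four corners cancel around the square. *)
    replace (I1 + I2 - I3 - I4)%C with
      ((I1 - (A (g (x + h)%R y) - A (g x y))) + (I2 - (A (g (x + h)%R (y + h)%R) - A (g (x + h)%R y)))
       + - (I3 - (A (g (x + h)%R (y + h)%R) - A (g x (y + h)%R))) + - (I4 - (A (g x (y + h)%R) - A (g x y))))%C by ring.
    eapply Rle_trans; [apply Cmod_triangle|].
    eapply Rle_trans; [apply Rplus_le_compat_r, Cmod_triangle|].
    eapply Rle_trans; [apply Rplus_le_compat_r, Rplus_le_compat_r, Cmod_triangle|].
    rewrite !Cmod_opp.
    assert (E : eta = q * (1 + 16 * M * M)) by (unfold q; field; lra).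
    rewrite E. assert (0 <= q * (h * h)) by (apply Rmult_le_pos; [lra | nra]).
    replace (h * (q * (4 * M * h) * M)) with (4 * (q * (h * h) * (M * M))) in B1, B2, B3, B4 by ring.
    replace (q * (1 + 16 * M * M) * (h * h)) with (q * (h * h) + 16 * (q * (h * h) * (M * M))) by ring.
    lra.
Qed.

(** * Cauchy's formula *)

(** Parametrised by [0, 1], so that averages over a circle are plain integrals and the parameter is
    a coordinate of the unit square in [Goursat]. *)
Definition circ (r y : R) : C := polar r (2 * PI * y).

Lemma Cmod_polar (r t : R) : 0 <= r -> Cmod (polar r t) = r.
Proof.
  intros Hr. unfold Cmod, polar; simpl fst; simpl snd.
  replace ((r * cos t) ^ 2 + (r * sin t) ^ 2) with (r ^ 2 * ((sin t)² + (cos t)²))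
    by (unfold Rsqr; ring).
  rewrite sin2_cos2, Rmult_1_r. apply sqrt_pow2; assumption.
Qed.

Lemma circ_scal (r y : R) : circ r y = (r * circ 1 y)%C.
Proof. unfold circ, polar, Cmult, RtoC; simpl. f_equal; ring. Qed.

Lemma cderiv_circ (r y : R) : cderiv (circ r) y (RtoC (2 * PI) * Ci * circ r y)%C.
Proof.
  unfold circ, polar; split; simpl; auto_derive; auto; ring.
Qed.

Lemma ccont_circ (r y : R) : ccont (circ r) y.
Proof. eapply cderiv_ccont, cderiv_circ. Qed.

(** For zeta = [circ r y], d zeta / (2 pi i) is zeta dy; this is why Cauchy's kernel appears as zeta
    / (zeta - z), with no outer constant. *)
Lemma ccont_Cauchy_integrand (f : C -> C) (r : R) (z : C) (y : R) :
  (forall w, Cmod w < 1 -> cdiff f w) -> Cmod z < r < 1 ->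
  ccont (fun y => f (circ r y) * (circ r y / (circ r y - z)))%C y.
Proof.
  intros Hf Hz. pose proof (Cmod_ge_0 z). apply ccont_mult.
  - apply (ccont_comp f (circ r)); [|apply ccont_circ]. apply Hf. unfold circ. rewrite Cmod_polar; lra.
  - apply ccont_mult; [apply ccont_circ|].
    apply (ccont_comp (fun w => / (w - z))%C (circ r)); [|apply ccont_circ].
    apply (cdiff_inv (fun w => w - z)%C); [|apply cdiff_sub_const].
    intros E. apply (Rlt_not_eq (Cmod z) r); [lra|].
    replace z with (circ r y) by (apply Ceq_minus; exact E).
    apply Cmod_polar; lra.
Qed.

(* Goursat is applied to the homotopy from the circle of radius [d] about [z] to the circle of radius [r] about [0]. *)
Lemma Cauchy_shrink (f : C -> C) (r d : R) (z : C) :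
  (forall w, Cmod w < 1 -> cdiff f w) -> Cmod z < r < 1 -> 0 < d -> Cmod z + d < 1 ->
  CInt (fun y => f (circ r y) * (circ r y / (circ r y - z)))%C 0 1
  = CInt (fun y => f (z + d * circ 1 y))%C 0 1.
Proof.
  intros Hf Hz Hd Hzd.
  pose proof (Cmod_ge_0 z) as Hz0.
  (* As x runs from 0 to 1 the radius moves linearly from d to r and the centre from z to 0. *)
  pose (rho := fun x : R => (1 - x) * d + x * r).
  pose (g := fun x y : R => (z * RtoC (1 - x) + RtoC (rho x) * circ 1 y)%C).
  pose (gx := fun x y : R => (- z + RtoC (r - d) * circ 1 y)%C).
  pose (gy := fun x y : R => (RtoC (rho x) * (RtoC (2 * PI) * Ci * circ 1 y))%C).
  pose (k := fun w : C => (f w * / (w - z))%C).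
  assert (Hc1 : forall y, Cmod (circ 1 y) = 1) by (intros; apply Cmod_polar; lra).
  assert (Hrho : forall x, 0 <= x <= 1 -> 0 < rho x) by (intros x Hx; unfold rho; nra).
  assert (HPI : 0 < PI) by apply PI_RGT_0.
  assert (G : square_int k g gx gy 0 0 1 = 0%C).
  { apply Goursat with (M := Rmax (Cmod z + Rabs (r - d)) (Rmax d r * (2 * PI))).
    - intros x y. split; unfold g, gx, rho, RtoC; simpl; auto_derive; auto; ring.
    - intros x y. unfold g, gy. eapply cderiv_eq.
      + apply (cderiv_plus (fun _ => (z * RtoC (1 - x))%C)); [apply cderiv_const|].
        apply (cderiv_mult (fun _ => RtoC (rho x))); [apply cderiv_const | apply cderiv_circ].
      + ring.
    - intros x y. apply ccont_const.
    - intros x y. unfold gy. repeat apply ccont_mult; try apply ccont_const. apply ccont_circ.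
    - intros x y Hx Hy. eapply Rle_trans; [|apply Rmax_l]. unfold gx.
      eapply Rle_trans; [apply Cmod_triangle|].
      rewrite Cmod_opp, Cmod_mult, Hc1, Cmod_R. lra.
    - intros x y Hx Hy. eapply Rle_trans; [|apply Rmax_r]. unfold gy.
      rewrite !Cmod_mult, Hc1, Cmod_Ci, !Cmod_R, !Rabs_pos_eq by (try apply Rlt_le, Hrho; lra).
      assert (rho x <= Rmax d r).
      { pose proof (Rmax_l d r). pose proof (Rmax_r d r). unfold rho. nra. }
      assert (rho x * (2 * PI) <= Rmax d r * (2 * PI)) by (apply Rmult_le_compat_r; lra). lra.
    - intros x y Hx Hy. apply cdiff_mult.
      (* The modulus is at most (1 - x)(|z| + d) + x r, a convex combination of two numbers below
         1. *)
      + apply Hf. unfold g. eapply Rle_lt_trans; [apply Cmod_triangle|].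
        rewrite !Cmod_mult, Hc1, !Cmod_R, !Rabs_pos_eq by (try apply Rlt_le, Hrho; lra).
        unfold rho. destruct (Rle_lt_dec x 0); nra.
      + apply (cdiff_inv (fun w => w - z)%C); [|apply cdiff_sub_const].
        apply Cmod_gt_0.
        (* The curves avoid z: the distance is at least rho x - x |z| = (1 - x) d + x (r - |z|) >
           0. *)
        replace (g x y - z)%C with (RtoC (rho x) * circ 1 y + - (RtoC x * z))%C
          by (unfold g; rewrite RtoC_minus; ring).
        assert (rho x <= Cmod (RtoC (rho x) * circ 1 y + - (RtoC x * z)) + x * Cmod z).
        { replace (rho x) with (Cmod ((RtoC (rho x) * circ 1 y + - (RtoC x * z)) + RtoC x * z)) at 1.
          - eapply Rle_trans; [apply Cmod_triangle|].
            rewrite (Cmod_mult (RtoC x)), Cmod_R, Rabs_pos_eq by lra. lra.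
          - replace (RtoC (rho x) * circ 1 y + - (RtoC x * z) + RtoC x * z)%C
              with (RtoC (rho x) * circ 1 y)%C by ring.
            rewrite Cmod_mult, Hc1, Cmod_R, Rabs_pos_eq by (apply Rlt_le, Hrho; lra). ring. }
        assert (x * Cmod z < rho x).
        { unfold rho. destruct (Rle_lt_dec x 0); nra. }
        lra. }
  unfold square_int, curve_int in G. rewrite Rplus_0_l in G.
  (* All circles are closed, so the sides y = 0 and y = 1 have the same image and cancel; only the
     initial and final circles remain in [G]. *)
  assert (E1 : circ 1 1 = circ 1 0).
  { unfold circ, polar. rewrite Rmult_1_r, Rmult_0_r, cos_2PI, sin_2PI, cos_0, sin_0. reflexivity. }
  rewrite (CInt_ext (fun t => k (g t 1) * gx t 1)%C (fun t => k (g t 0) * gx t 0)%C) in G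
    by (intros t; unfold g, gx; rewrite E1; reflexivity).
  assert (Hne : forall x, 0 < x -> forall y, (RtoC x * circ 1 y)%C <> 0%C).
  { intros x Hx y. apply Cmod_gt_0. rewrite Cmod_mult, Hc1, Cmod_R, Rabs_pos_eq; lra. }
  assert (I1 : is_CInt (fun y => k (g 1 y) * gy 1 y)%C 0 1
     (RtoC (2 * PI) * Ci * CInt (fun y => f (circ r y) * (circ r y / (circ r y - z)))%C 0 1)%C).
  { eapply is_CInt_ext; [lra| |apply is_CInt_scal, CInt_correct; [lra|]].
    - intros t _. unfold k, g, gy, rho. simpl.
      replace (z * RtoC (1 - 1) + RtoC ((1 - 1) * d + 1 * r) * circ 1 t)%C with (circ r t).
      2:{ rewrite (circ_scal r). replace (1 - 1) with 0 by ring.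
          replace (0 * d + 1 * r) with r by ring. ring. }
      replace ((1 - 1) * d + 1 * r) with r by ring.
      replace (RtoC r * (RtoC (2 * PI) * Ci * circ 1 t))%C with (RtoC (2 * PI) * Ci * circ r t)%C
        by (rewrite (circ_scal r); ring).
      unfold Cdiv. ring.
    - intros t _. apply ccont_Cauchy_integrand; assumption. }
  assert (I0 : is_CInt (fun y => k (g 0 y) * gy 0 y)%C 0 1
     (RtoC (2 * PI) * Ci * CInt (fun y => f (z + d * circ 1 y))%C 0 1)%C).
  { eapply is_CInt_ext; [lra| |apply is_CInt_scal, CInt_correct; [lra|]].
    - intros t _. unfold k, g, gy, rho. simpl.
      replace (1 - 0) with 1 by ring. replace (1 * d + 0 * r) with d by ring.
      replace (z * RtoC 1 + RtoC d * circ 1 t)%C with (z + RtoC d * circ 1 t)%C by ring.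
      replace (z + RtoC d * circ 1 t - z)%C with (RtoC d * circ 1 t)%C by ring.
      set (F := f _). field. specialize (Hne d Hd t).
      split; intros E; apply Hne; rewrite E; ring.
    - intros t _. apply (ccont_comp f (fun y => z + d * circ 1 y)%C).
      + apply Hf. eapply Rle_lt_trans; [apply Cmod_triangle|].
        rewrite Cmod_mult, Hc1, Cmod_R, Rabs_pos_eq; lra.
      + apply ccont_plus; [apply ccont_const|]. apply ccont_mult; [apply ccont_const|apply ccont_circ]. }
  apply CInt_eq in I1, I0.
  rewrite I1, I0 in G.
  set (U := CInt (fun y => f (circ r y) * _)%C 0 1) in *.
  set (V := CInt (fun y => f (z + _))%C 0 1) in *.
  set (W := CInt _ 0 1) in G.
  assert (Hpi : RtoC (2 * PI) <> 0%C).
  { apply Cmod_gt_0. rewrite Cmod_R, Rabs_pos_eq; lra. }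
  apply Ceq_minus.
  replace (U - V)%C with ((W + RtoC (2 * PI) * Ci * U - W - RtoC (2 * PI) * Ci * V) / (RtoC (2 * PI) * Ci))%C
    by (field; split; [apply Ci_nz | exact Hpi]).
  rewrite G. unfold Cdiv. ring.
Qed.

(** By [Cauchy_shrink] the integral equals the mean of f over every sufficiently small circle about
    z, and continuity at z brings that mean within any e of f z. *)
Lemma Cauchy_formula (f : C -> C) (r : R) (z : C) :
  (forall w, Cmod w < 1 -> cdiff f w) -> Cmod z < r < 1 ->
  is_CInt (fun y => f (circ r y) * (circ r y / (circ r y - z)))%C 0 1 (f z).
Proof.
  intros Hf Hz. pose proof (Cmod_ge_0 z) as Hz0.
  set (L := CInt (fun y => f (circ r y) * (circ r y / (circ r y - z)))%C 0 1).
  assert (HL : is_CInt (fun y => f (circ r y) * (circ r y / (circ r y - z)))%C 0 1 L).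
  { apply CInt_correct; [lra|]. intros t _. apply ccont_Cauchy_integrand; assumption. }
  replace (f z) with L; [exact HL|].
  apply Ceq_minus, Cmod_eq_0, Rle_antisym; [|apply Cmod_ge_0].
  apply le_epsilon; intros e He.
  rewrite Rplus_0_l.
  destruct (cdiff_continuous f z (Hf z ltac:(lra)) e He) as [d [Hd Hd']].
  set (q := Rmin (d / 2) ((1 - Cmod z) / 2)).
  assert (Hq : 0 < q) by (apply Rmin_pos; lra).
  assert (Hq1 : q <= d / 2) by apply Rmin_l.
  assert (Hq2 : q <= (1 - Cmod z) / 2) by apply Rmin_r.
  assert (Hc1 : forall y, Cmod (circ 1 y) = 1) by (intros; apply Cmod_polar; lra).
  unfold L. rewrite (Cauchy_shrink f r q z Hf Hz Hq ltac:(lra)).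
  replace e with ((1 - 0) * e) by ring.
  apply (Cmod_CInt_le_const (fun y => f (z + q * circ 1 y) - f z)%C); [lra| |].
  - intros t _. left. apply Hd'.
    replace (z + q * circ 1 t - z)%C with (RtoC q * circ 1 t)%C by ring.
    rewrite Cmod_mult, Hc1, Cmod_R, Rabs_pos_eq; lra.
  - apply is_CInt_minus.
    + apply CInt_correct; [lra|]. intros t _. apply (ccont_comp f (fun y => z + q * circ 1 y)%C).
      * apply Hf. eapply Rle_lt_trans; [apply Cmod_triangle|].
        rewrite Cmod_mult, Hc1, Cmod_R, Rabs_pos_eq; lra.
      * apply ccont_plus; [apply ccont_const|]. apply ccont_mult; [apply ccont_const|apply ccont_circ].
    + apply is_CInt_const.
Qed.

(** * Partial fractions and Blaschke products *)

Definition lsum (F : C -> C) (l : list C) : C := fold_right (fun a s => F a + s)%C (RtoC 0) l.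
Definition lprod (F : C -> C) (l : list C) : C := fold_right (fun a s => F a * s)%C (RtoC 1) l.
Definition lsumR (F : C -> R) (l : list C) : R := fold_right (fun a s => F a + s) 0 l.

Lemma lsum_ext (F G : C -> C) (l : list C) :
  (forall a, In a l -> F a = G a) -> lsum F l = lsum G l.
Proof.
  induction l as [|b l IH]; simpl; intros H; [reflexivity|].
  rewrite (H b) by auto. rewrite IH; auto.
Qed.

Lemma lsum_scal (c : C) (F : C -> C) (l : list C) :
  (lsum (fun a => c * F a) l = c * lsum F l)%C.
Proof. induction l as [|b l IH]; simpl; [ring|]. rewrite IH. ring. Qed.

Lemma lsum_minus (F G : C -> C) (l : list C) :
  (lsum (fun a => F a - G a) l = lsum F l - lsum G l)%C.
Proof. induction l as [|b l IH]; simpl; [ring|]. rewrite IH. ring. Qed.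

Lemma Cmod_lsum_le (F : C -> C) (c : C -> R) (l : list C) :
  (forall a, In a l -> Cmod (F a) <= c a) -> Cmod (lsum F l) <= lsumR c l.
Proof.
  induction l as [|b l IH]; simpl; intros H; [rewrite Cmod_0; lra|].
  eapply Rle_trans; [apply Cmod_triangle|]. apply Rplus_le_compat; auto.
Qed.

Lemma lsumR_scal (c : R) (F : C -> R) (l : list C) :
  lsumR (fun a => c * F a) l = c * lsumR F l.
Proof. induction l as [|b l IH]; simpl; [ring|]. rewrite IH. ring. Qed.

Lemma lsumR_nonneg (F : C -> R) (l : list C) : (forall a, 0 <= F a) -> 0 <= lsumR F l.
Proof. intros H; induction l as [|b l IH]; simpl; [lra|]. specialize (H b); lra. Qed.

Lemma is_CInt_lsum (F : C -> R -> C) (L : C -> C) (l : list C) :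
  (forall a, In a l -> is_CInt (F a) 0 1 (L a)) ->
  is_CInt (fun y => lsum (fun a => F a y) l) 0 1 (lsum L l).
Proof.
  induction l as [|b l IH]; simpl; intros H; [apply is_CInt_const|].
  apply is_CInt_plus; auto.
Qed.

Lemma cdiff_lprod (F : C -> C -> C) (l : list C) (p : C) :
  (forall a, cdiff (F a) p) -> cdiff (fun w => lprod (fun a => F a w) l) p.
Proof.
  intros H; induction l as [|b l IH]; simpl; [apply cdiff_const|].
  apply cdiff_mult; auto.
Qed.

Lemma lprod_neq_0 (F : C -> C) (l : list C) :
  (forall a, In a l -> F a <> 0%C) -> lprod F l <> 0%C.
Proof.
  induction l as [|b l IH]; simpl; intros H; [apply C1_nz|].
  apply Cmult_neq_0; auto.
Qed.

Lemma Cmod_lprod_le (F : C -> C) (m : R) (l : list C) :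
  0 <= m -> (forall a, In a l -> Cmod (F a) <= m) -> Cmod (lprod F l) <= m ^ length l.
Proof.
  intros Hm; induction l as [|b l IH]; simpl; intros H; [rewrite Cmod_1; lra|].
  rewrite Cmod_mult. apply Rmult_le_compat; try apply Cmod_ge_0; auto.
Qed.

Lemma Cmod_lprod_ge (F : C -> C) (m : R) (l : list C) :
  0 <= m -> (forall a, In a l -> m <= Cmod (F a)) -> m ^ length l <= Cmod (lprod F l).
Proof.
  intros Hm; induction l as [|b l IH]; simpl; intros H; [rewrite Cmod_1; lra|].
  rewrite Cmod_mult. apply Rmult_le_compat; auto. apply pow_le; assumption.
Qed.

(* The finite Blaschke product with zeros [l] is [bnum l z / bden l z]. *)
Definition bnum (l : list C) (z : C) : C := lprod (fun a => z - a)%C l.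
Definition bden (l : list C) (z : C) : C := lprod (fun a => 1 - Cconj a * z)%C l.

Lemma Cminus_neq_0 (a b : C) : a <> b -> (a - b)%C <> 0%C.
Proof. intros H E. apply H, Ceq_minus, E. Qed.

Lemma bnum_neq_0 (l : list C) (z : C) : ~ In z l -> bnum l z <> 0%C.
Proof.
  intros H. apply lprod_neq_0. intros a Ha. apply Cminus_neq_0. intros E; subst; auto.
Qed.

Lemma partial_fractions (l : list C) : NoDup l -> l <> nil ->
  exists c : C -> C, forall w, ~ In w l -> (/ bnum l w = lsum (fun a => c a / (w - a)) l)%C.
Proof.
  induction l as [|b l IH]; intros Hl Hne; [congruence|].
  inversion Hl as [|? ? Hb Hl']; subst.
  destruct l as [|b' l'].
  { exists (fun _ => 1%C). intros w Hw. unfold bnum; simpl.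
    assert (w - b <> 0)%C by (apply Cminus_neq_0; intros E; subst; apply Hw; left; reflexivity).
    field. assumption. }
  set (l := b' :: l') in *. destruct (IH Hl') as [c Hc]; [discriminate|].
  set (s := lsum (fun a => c a / (a - b))%C l).
  (* From 1/((w - a)(w - b)) = (1/(w - a) - 1/(w - b)) / (a - b): old coefficients are divided by a
     - b, and the new node b collects minus their sum, which is the residue 1 / [bnum l b]. *)
  exists (fun a => if Ceq_dec a b then - s else c a / (a - b))%C.
  intros w Hw.
  assert (Hwb : (w - b <> 0)%C) by (apply Cminus_neq_0; intros E; subst; apply Hw; left; reflexivity).
  assert (Hwl : ~ In w l) by (intros E; apply Hw; right; assumption).
  change (/ ((w - b) * bnum l w) =
    (if Ceq_dec b b then - s else c b / (b - b)) / (w - b) +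
     lsum (fun a => (if Ceq_dec a b then - s else c a / (a - b)) / (w - a)) l)%C.
  destruct (Ceq_dec b b) as [_|]; [|congruence].
  rewrite (lsum_ext _ (fun a => / (w - b) * (c a / (w - a)) - (- / (w - b)) * (c a / (a - b)))%C).
  - rewrite lsum_minus, !lsum_scal, <- (Hc w Hwl). fold s.
    field. split; [|apply bnum_neq_0]; assumption.
  - intros a Ha.
    assert (Hab : a <> b) by (intros E; subst; contradiction).
    destruct (Ceq_dec a b) as [|_]; [contradiction|].
    field. repeat split; try assumption; apply Cminus_neq_0; [assumption|].
    intros E; subst; contradiction.
Qed.

Lemma circ_notin (r y : R) (a : C) : 0 <= Cmod a < r -> circ r y <> a.
Proof.
  intros H E. apply (Rlt_not_eq (Cmod a) r); [lra|]. rewrite <- E. apply Cmod_polar; lra.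
Qed.

(** No residue theorem is needed: Cauchy's formula at z and at a node a gives c_a (G z - G a)/(z -
    a) as one integral, because 1/(zeta - z) - 1/(zeta - a) = (z - a)/((zeta - z)(zeta - a)).
    Summing over the nodes reassembles 1 / [bnum] under the integral. *)
Lemma Hermite_remainder (c : C -> C) (G : C -> C) (l : list C) (r : R) (z : C) :
  (forall w, ~ In w l -> (/ bnum l w = lsum (fun a => c a / (w - a)) l)%C) ->
  (forall w, Cmod w < 1 -> cdiff G w) ->
  Cmod z < r < 1 -> (forall a, In a l -> Cmod a < r) -> ~ In z l ->
  is_CInt (fun y => G (circ r y) * / bnum l (circ r y) * (circ r y / (circ r y - z)))%C 0 1
    (G z / bnum l z - lsum (fun a => c a / (z - a) * G a) l)%C.
Proof.
  intros Hc HG Hz Hl Hzl. pose proof (Cmod_ge_0 z) as Hz0.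
  assert (E : (G z / bnum l z - lsum (fun a => c a / (z - a) * G a) l
    = lsum (fun a => c a / (z - a) * (G z - G a)) l)%C).
  { unfold Cdiv at 1. rewrite (Hc z Hzl), <- lsum_scal, <- lsum_minus.
    apply lsum_ext. intros a Ha. unfold Cminus. ring. }
  rewrite E. clear E.
  eapply is_CInt_ext; [lra| |
    apply (is_CInt_lsum (fun a y => c a / (z - a) *
      (G (circ r y) * (circ r y / (circ r y - z)) - G (circ r y) * (circ r y / (circ r y - a))))%C)].
  - intros y _. simpl.
    assert (Hy : ~ In (circ r y) l).
    { intros Hy. specialize (Hl _ Hy). unfold circ in Hl. rewrite Cmod_polar in Hl; lra. }
    rewrite (Hc _ Hy).
    replace (G (circ r y) * lsum (fun a => c a / (circ r y - a)) l * (circ r y / (circ r y - z)))%C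
      with ((G (circ r y) * (circ r y / (circ r y - z))) * lsum (fun a => c a / (circ r y - a)) l)%C
      by ring.
    rewrite <- lsum_scal. apply lsum_ext. intros a Ha.
    assert (circ r y - z <> 0)%C by (apply Cminus_neq_0, circ_notin; lra).
    assert (circ r y - a <> 0)%C
      by (apply Cminus_neq_0, circ_notin; split; [apply Cmod_ge_0 | apply Hl; assumption]).
    assert (z - a <> 0)%C by (apply Cminus_neq_0; intros E; subst; contradiction).
    field. auto.
  - intros a Ha. apply is_CInt_scal. apply is_CInt_minus; apply Cauchy_formula; auto.
    split; [apply Hl; assumption | lra].
Qed.

(** * Estimates for Blaschke factors and products *)

Lemma Cmod2_sq (z : C) : Cmod z * Cmod z = Re z * Re z + Im z * Im z.
Proof. replace (Cmod z * Cmod z) with (Cmod z ^ 2) by ring. rewrite Cmod2_alt. ring. Qed.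

Lemma Blaschke_identity (a z : C) :
  Cmod (1 - Cconj a * z) * Cmod (1 - Cconj a * z) - Cmod (z - a) * Cmod (z - a)
  = (1 - Cmod a * Cmod a) * (1 - Cmod z * Cmod z).
Proof.
  rewrite !Cmod2_sq. destruct a as [a1 a2], z as [z1 z2]. simpl. ring.
Qed.

Lemma Cmod_bden_factor (a z : C) : Cmod a < 1 ->
  1 - Cmod z <= Cmod (1 - Cconj a * z) <= 1 + Cmod z.
Proof.
  intros Ha. pose proof (Cmod_ge_0 a). pose proof (Cmod_ge_0 z).
  assert (E : Cmod (Cconj a * z) <= Cmod z) by (rewrite Cmod_mult, Cmod_conj; nra).
  split.
  - assert (1 <= Cmod (1 - Cconj a * z) + Cmod (Cconj a * z)); [|lra].
    rewrite <- Cmod_1 at 1. replace (RtoC 1) with ((1 - Cconj a * z) + Cconj a * z)%C at 1 by ring.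
    apply Cmod_triangle.
  - eapply Rle_trans; [apply Cmod_triangle|]. rewrite Cmod_opp, Cmod_1. lra.
Qed.

(** Let x be the quantity in the exponent. The identity gives v^2 <= u^2 - 8 x, since (1 - |a|)(1 -
    R0) = 8 x; then u^2 <= 4 yields v^2 <= u^2 (1 - 2 x) <= u^2 exp(-2 x). The 8 is this 4 times the
    2 lost to the square root. The exponential form turns a product of factors into the sum of 1 -
    |a|. *)
Lemma Blaschke_factor_upper (a z : C) (R0 : R) : Cmod a < 1 -> Cmod z <= R0 < 1 ->
  Cmod (z - a) <= exp (- ((1 - R0) / 8 * (1 - Cmod a))) * Cmod (1 - Cconj a * z).
Proof.
  intros Ha Hz. pose proof (Cmod_ge_0 a). pose proof (Cmod_ge_0 z).
  pose proof (Cmod_bden_factor a z Ha) as [B1 B2].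
  pose proof (Blaschke_identity a z) as E.
  pose proof (Cmod_ge_0 (z - a)).
  set (u := Cmod (1 - Cconj a * z)) in *. set (v := Cmod (z - a)) in *.
  set (x := (1 - R0) / 8 * (1 - Cmod a)).
  assert (Hx : 0 <= x) by (unfold x; apply Rmult_le_pos; lra).
  assert (He : 1 - 2 * x <= exp (- x) * exp (- x)).
  { rewrite <- exp_plus. pose proof (exp_ineq1_le (- x + - x)). lra. }
  pose proof (exp_pos (- x)) as Hp.
  apply Rsqr_incr_0_var; [unfold Rsqr | apply Rmult_le_pos; lra].
  assert (Hprod : 8 * x <= (1 - Cmod a * Cmod a) * (1 - Cmod z * Cmod z)).
  { unfold x. replace (8 * ((1 - R0) / 8 * (1 - Cmod a))) with ((1 - Cmod a) * (1 - R0)) by field.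
    apply Rmult_le_compat; nra. }
  assert (Hu : u * u <= 4) by nra.
  assert (v * v <= u * u * (1 - 2 * x)) by nra.
  replace (exp (- x) * u * (exp (- x) * u)) with (u * u * (exp (- x) * exp (- x))) by ring.
  assert (u * u * (1 - 2 * x) <= u * u * (exp (- x) * exp (- x))) by (apply Rmult_le_compat_l; nra).
  lra.
Qed.

Lemma Blaschke_product_upper (l : list C) (z : C) (R0 : R) :
  (forall a, In a l -> Cmod a < 1) -> Cmod z <= R0 < 1 ->
  Cmod (bnum l z) <= exp (- ((1 - R0) / 8 * lsumR (fun a => 1 - Cmod a) l)) * Cmod (bden l z).
Proof.
  intros Hl Hz. induction l as [|b l IH].
  - simpl. rewrite Rmult_0_r, Ropp_0, exp_0, Cmod_1. lra.
  - unfold bnum, bden; simpl. rewrite !Cmod_mult.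
    rewrite Rmult_plus_distr_l, Ropp_plus_distr, exp_plus.
    eapply Rle_trans.
    + apply Rmult_le_compat; try apply Cmod_ge_0.
      * apply (Blaschke_factor_upper b z R0); [apply Hl; left; reflexivity | exact Hz].
      * apply IH. intros a Ha; apply Hl; right; assumption.
    + right. unfold bden. ring.
Qed.

Lemma Blaschke_factor_lower (a : C) (c : R) : Cmod a < 1 -> 0 < c < 1 ->
  exists rho, rho < 1 /\ forall z, rho < Cmod z < 1 -> c * Cmod (1 - Cconj a * z) <= Cmod (z - a).
Proof.
  intros Ha Hc. pose proof (Cmod_ge_0 a).
  (* For |z| > 1 - k, (1 - |a|^2)(1 - |z|^2) <= 2 (1 - |a|) * 2 k = (1 - c^2)(1 - |a|)^2, which is
     at most (1 - c^2) u^2; the identity then leaves v^2 >= c^2 u^2. *)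
  set (k := (1 - c * c) * (1 - Cmod a) / 4).
  assert (Hk : 0 < k) by (unfold k; apply Rdiv_lt_0_compat; [apply Rmult_lt_0_compat; nra | lra]).
  exists (1 - k). split; [lra|]. intros z Hz.
  pose proof (Blaschke_identity a z) as E.
  (* The general bound is used with a and z exchanged: 1 - |z| would degenerate at the boundary,
     whereas 1 - |a| does not. *)
  assert (Hlow : 1 - Cmod a <= Cmod (1 - Cconj a * z)).
  { pose proof (Cmod_bden_factor (Cconj z) (Cconj a)) as [B _]; [rewrite Cmod_conj; lra|].
    rewrite Cmod_conj, Cconj_conj, (Cmult_comm z) in B. exact B. }
  pose proof (Cmod_ge_0 (z - a)) as Hv. pose proof (Cmod_ge_0 z) as Hs.
  set (u := Cmod (1 - Cconj a * z)) in *. set (v := Cmod (z - a)) in *.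
  set (s := Cmod z) in *. set (t := Cmod a) in *.
  apply Rsqr_incr_0_var; [unfold Rsqr | assumption].
  assert ((1 - t * t) * (1 - s * s) <= (1 - c * c) * (u * u)); [|nra].
  assert (H1 : 1 - s * s <= 2 * k) by nra.
  assert (H2 : 1 - t * t <= 2 * (1 - t)) by nra.
  assert (H3 : 0 <= 1 - t * t) by nra.
  assert (H4 : (1 - t * t) * (1 - s * s) <= 2 * (1 - t) * (2 * k)) by (apply Rmult_le_compat; nra).
  assert (H5 : 2 * (1 - t) * (2 * k) = (1 - c * c) * ((1 - t) * (1 - t))) by (unfold k; field).
  assert (H6 : (1 - t) * (1 - t) <= u * u) by nra.
  assert (0 <= 1 - c * c) by nra.
  assert ((1 - c * c) * ((1 - t) * (1 - t)) <= (1 - c * c) * (u * u)) by (apply Rmult_le_compat_l; assumption).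
  lra.
Qed.

Lemma Blaschke_product_lower (l : list C) : (forall a, In a l -> Cmod a < 1) ->
  forall c, 0 < c < 1 -> exists rho, rho < 1 /\
    forall z, rho < Cmod z < 1 -> c * Cmod (bden l z) <= Cmod (bnum l z).
Proof.
  induction l as [|b l IH]; intros Hl c Hc.
  - exists 0. split; [lra|]. intros z _. simpl. rewrite Cmod_1. lra.
  (* The loss is shared between head and tail, using ((1 + c)/2)^2 >= c. *)
  - destruct (Blaschke_factor_lower b ((1 + c) / 2)) as [r1 [H1 B1]];
      [apply Hl; left; reflexivity | lra |].
    destruct (IH (fun a Ha => Hl a (or_intror Ha)) ((1 + c) / 2)) as [r2 [H2 B2]]; [lra|].
    exists (Rmax r1 r2). split; [apply Rmax_lub_lt; assumption|]. intros z Hz.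
    pose proof (Rmax_l r1 r2). pose proof (Rmax_r r1 r2).
    specialize (B1 z ltac:(lra)). specialize (B2 z ltac:(lra)).
    unfold bnum, bden; simpl. rewrite !Cmod_mult. fold (bnum l z) (bden l z).
    pose proof (Cmod_ge_0 (1 - Cconj b * z)) as P1. pose proof (Cmod_ge_0 (bden l z)) as P2.
    eapply Rle_trans; [|apply Rmult_le_compat; [| |exact B1|exact B2]];
      try (apply Rmult_le_pos; lra).
    replace ((1 + c) / 2 * Cmod (1 - Cconj b * z) * ((1 + c) / 2 * Cmod (bden l z)))
      with ((1 + c) / 2 * ((1 + c) / 2) * (Cmod (1 - Cconj b * z) * Cmod (bden l z))) by ring.
    apply Rmult_le_compat_r; [apply Rmult_le_pos; assumption | nra].
Qed.

(** * Interpolation estimate *)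

Lemma finite_in_smaller_disc (l : list C) : (forall a, In a l -> Cmod a < 1) ->
  exists rho, rho < 1 /\ forall a, In a l -> Cmod a <= rho.
Proof.
  induction l as [|b l IH]; intros H.
  - exists 0. split; [lra | intros a []].
  - destruct IH as [r [Hr Hr']]; [intros; apply H; right; assumption|].
    exists (Rmax (Cmod b) r). split; [apply Rmax_lub_lt; [apply H; left; reflexivity | assumption]|].
    intros a [<-|Ha]; [apply Rmax_l|]. eapply Rle_trans; [apply Hr', Ha | apply Rmax_r].
Qed.

(** [K] and [rho] depend on the nodes alone, so the same pair serves every g, z and r. The
    inequality is kept multiplied by |[bden l z]|, so that |B(z)| appears only on division at the
    very end. *)
Lemma interpolation_estimate (l : list C) :
  NoDup l -> l <> nil -> (forall a, In a l -> Cmod a < 1) ->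
  exists K rho, 0 <= K /\ rho < 1 /\ forall g eps R0 r z m,
    (forall w, Cmod w < 1 -> cdiff g w) ->
    (forall a, In a l -> Cmod (g a) <= eps) ->
    Cmod z <= R0 -> R0 < r < 1 -> rho < r -> ~ In z l ->
    is_RInt (fun y => Cmod (g (circ r y))) 0 1 m ->
    Cmod (bden l z) * Cmod (g z) <= K * eps + Cmod (bnum l z) * (2 / (r - R0) * m).
Proof.
  intros Hnd Hne Hl.
  destruct (partial_fractions l Hnd Hne) as [c Hc].
  destruct (finite_in_smaller_disc l Hl) as [r1 [Hr1 H1]].
  destruct (Blaschke_product_lower l Hl (1 / 2)) as [r2 [Hr2 H2]]; [lra|].
  set (D := lsumR (fun a => Cmod (c a)) l).
  assert (HD : 0 <= D) by (apply lsumR_nonneg; intros; apply Cmod_ge_0).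
  (* One power of 2 bounds [bnum l z / (z - a)], the other bounds [bden l a]; [D] is the sum of the
     moduli of the coefficients. *)
  exists (2 ^ length l * 2 ^ length l * D), (Rmax r1 r2).
  assert (H2n : 0 <= 2 ^ length l) by (apply pow_le; lra).
  split; [repeat apply Rmult_le_pos; assumption|].
  split; [apply Rmax_lub_lt; assumption|].
  intros g eps R0 r z m Hg Heps Hz Hr Hrho Hzl Hm.
  pose proof (Rmax_l r1 r2). pose proof (Rmax_r r1 r2). pose proof (Cmod_ge_0 z) as Hz0.
  pose (G := fun w => (g w * bden l w)%C).
  assert (HG : forall w, Cmod w < 1 -> cdiff G w).
  { intros w Hw. apply cdiff_mult; [apply Hg, Hw|].
    apply (cdiff_lprod (fun a w => 1 - Cconj a * w)%C). intros a.
    apply (cdiff_ext (fun w => 1 + - Cconj a * w)%C); [intros; ring|].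
    apply cdiff_plus; [apply cdiff_const|]. apply cdiff_mult; [apply cdiff_const | apply cdiff_id]. }
  pose proof (Hermite_remainder c G l r z Hc HG ltac:(lra)
    ltac:(intros a Ha; specialize (H1 a Ha); lra) Hzl) as HI.
  assert (Hbz : bnum l z <> 0%C) by (apply bnum_neq_0, Hzl).
  set (S := lsum (fun a => c a / (z - a) * G a)%C l) in HI.
  (* The 2 comes from |B| >= 1/2 on the circle; the kernel r / |w - z| is at most 1 / (r - R0)
     because r < 1. *)
  assert (HIb : Cmod (G z / bnum l z - S) <= 2 / (r - R0) * m).
  { eapply (Cmod_CInt_le _ (fun y => 2 / (r - R0) * Cmod (g (circ r y)))); [| |exact HI|].
    - lra.
    - intros y _. simpl. unfold G. set (w := circ r y).
      assert (Hw : Cmod w = r) by (apply Cmod_polar; lra).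
      assert (Hwl : ~ In w l) by (intros E; specialize (H1 w E); lra).
      assert (Hbw : 0 < Cmod (bnum l w)) by (apply Cmod_gt_0, bnum_neq_0, Hwl).
      assert (Hwz : r - R0 <= Cmod (w - z)).
      { assert (Cmod w <= Cmod (w - z) + Cmod z); [|lra].
        replace w with ((w - z) + z)%C at 1 by ring. apply Cmod_triangle. }
      assert (Hwz0 : (w - z)%C <> 0%C) by (apply Cmod_gt_0; lra).
      rewrite !Cmod_mult, Cmod_inv, Cmod_div, Hw by (try assumption; apply bnum_neq_0; assumption).
      specialize (H2 w ltac:(lra)).
      pose proof (Cmod_ge_0 (g w)) as Hgw.
      replace (Cmod (g w) * Cmod (bden l w) * / Cmod (bnum l w) * (r / Cmod (w - z)))
        with ((Cmod (bden l w) * / Cmod (bnum l w)) * (r / Cmod (w - z)) * Cmod (g w))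
        by (field; lra).
      apply Rmult_le_compat_r; [assumption|].
      unfold Rdiv at 2. apply Rmult_le_compat.
      + apply Rmult_le_pos; [apply Cmod_ge_0 | left; apply Rinv_0_lt_compat; assumption].
      + apply Rmult_le_pos; [lra | left; apply Rinv_0_lt_compat; lra].
      + apply Rle_div_l; [assumption | lra].
      + replace (r / Cmod (w - z)) with (r * / Cmod (w - z)) by reflexivity.
        rewrite <- (Rmult_1_l (/ (r - R0))).
        apply Rmult_le_compat; [lra | left; apply Rinv_0_lt_compat; lra | lra |].
        apply Rinv_le_contravar; lra.
    - apply (is_RInt_scal (V := R_NormedModule)). exact Hm. }
  assert (HS : Cmod (bnum l z * S) <= 2 ^ length l * 2 ^ length l * D * eps).
  { unfold S. rewrite <- lsum_scal.
    replace (2 ^ length l * 2 ^ length l * D * eps) with (2 ^ length l * 2 ^ length l * eps * D) by ring.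
    unfold D. rewrite <- lsumR_scal. apply Cmod_lsum_le. intros a Ha.
    assert (Hza : (z - a)%C <> 0%C) by (apply Cminus_neq_0; intros E; subst; contradiction).
    assert (Hq : Cmod (bnum l z / (z - a)) <= 2 ^ length l).
    (* One factor z - a is split off wherever a occurs in the list; every other factor is at most 2,
       and one spare 2 is given away. *)
    { assert (HQ : forall l', (forall a, In a l' -> Cmod a < 1) -> In a l' ->
         Cmod (bnum l' z) <= Cmod (z - a) * 2 ^ length l').
      { induction l' as [|b l' IH]; [intros _ [] | intros Hl' [<-|Ha']].
        - unfold bnum; simpl. rewrite Cmod_mult. apply Rmult_le_compat_l; [apply Cmod_ge_0|].
          assert (Cmod (lprod (fun a => z - a)%C l') <= 2 ^ length l').
          { apply Cmod_lprod_le; [lra|]. intros x Hx. eapply Rle_trans; [apply Cmod_triangle|].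
            rewrite Cmod_opp. specialize (Hl' x (or_intror Hx)). lra. }
          assert (0 <= 2 ^ length l') by (apply pow_le; lra). lra.
        - unfold bnum; simpl. rewrite Cmod_mult.
          assert (Hb : Cmod (z - b) <= 2).
          { eapply Rle_trans; [apply Cmod_triangle|]. rewrite Cmod_opp.
            specialize (Hl' b (or_introl eq_refl)). lra. }
          specialize (IH (fun x Hx => Hl' x (or_intror Hx)) Ha').
          replace (Cmod (z - a) * (2 * 2 ^ length l')) with (2 * (Cmod (z - a) * 2 ^ length l')) by ring.
          apply Rmult_le_compat; try apply Cmod_ge_0; assumption. }
      rewrite Cmod_div by assumption. apply Rle_div_l; [apply Cmod_gt_0; assumption|].
      rewrite Rmult_comm. apply HQ; assumption. }
    assert (HGa : Cmod (G a) <= 2 ^ length l * eps).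
    { unfold G. rewrite Cmod_mult, Rmult_comm.
      apply Rmult_le_compat; try apply Cmod_ge_0; [|apply Heps, Ha].
      apply Cmod_lprod_le; [lra|]. intros x Hx. eapply Rle_trans; [apply Cmod_bden_factor, Hl, Hx|].
      specialize (Hl a Ha). lra. }
    replace (bnum l z * (c a / (z - a) * G a))%C with (bnum l z / (z - a) * G a * c a)%C
      by (field; assumption).
    rewrite !Cmod_mult. apply Rmult_le_compat_r; [apply Cmod_ge_0|].
    replace (2 ^ length l * 2 ^ length l * eps) with (2 ^ length l * (2 ^ length l * eps)) by ring.
    apply Rmult_le_compat; try apply Cmod_ge_0; assumption. }
  rewrite <- Cmod_mult.
  replace (bden l z * g z)%C with (bnum l z * S + bnum l z * (G z / bnum l z - S))%C
    by (unfold G; field; assumption).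
  eapply Rle_trans; [apply Cmod_triangle|]. rewrite (Cmod_mult (bnum l z) (_ - _)%C).
  apply Rplus_le_compat; [assumption|]. apply Rmult_le_compat_l; [apply Cmod_ge_0 | assumption].
Qed.

(** Indices 0 to n inclusive, hence n + 1 points: this matches the range of [sum_n], and the list is
    never empty, as [partial_fractions] requires. *)
Fixpoint first_points (zs : nat -> C) (n : nat) : list C :=
  match n with O => zs O :: nil | S m => zs (S m) :: first_points zs m end.

Lemma In_first_points (zs : nat -> C) (n : nat) (a : C) :
  In a (first_points zs n) -> exists j, (j <= n)%nat /\ a = zs j.
Proof.
  induction n as [|n IH]; simpl.
  - intros [<-|[]]. exists 0%nat; auto.
  - intros [<-|H]; [exists (S n); auto|]. destruct (IH H) as [j [Hj E]]. exists j; auto.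
Qed.

Lemma NoDup_first_points (zs : nat -> C) (n : nat) :
  (forall i j, zs i = zs j -> i = j) -> NoDup (first_points zs n).
Proof.
  intros Hinj; induction n as [|n IH]; simpl; constructor; auto; try constructor.
  intros H. destruct (In_first_points _ _ _ H) as [j [Hj E]]. apply Hinj in E. lia.
Qed.

Lemma lsumR_first_points (F : C -> R) (zs : nat -> C) (n : nat) :
  lsumR F (first_points zs n) = sum_n (fun j => F (zs j)) n.
Proof.
  induction n as [|n IH]; simpl; [rewrite sum_O; ring|].
  rewrite sum_Sn, IH. unfold plus; simpl. ring.
Qed.

(** * Hardy means and the limit *)

Lemma rpow_nonneg (x p : R) : 0 <= rpow x p.
Proof. unfold rpow. destruct Req_EM_T; [lra|]. left; apply exp_pos. Qed.

Lemma rpow_le_self (x q : R) : 1 <= q -> 0 <= x <= 1 -> rpow x q <= x.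
Proof.
  intros Hq Hx. unfold rpow. destruct Req_EM_T; [lra|].
  rewrite <- (Rpower_1 x) at 2 by lra. unfold Rpower.
  assert (ln x <= 0). { rewrite <- ln_1. apply ln_le; lra. }
  apply Rnot_lt_le. intros HH. apply exp_lt_inv in HH. nra.
Qed.

(** A crude substitute for Jensen's inequality between the mean of |g| and its q-th mean; a bound
    independent of g is all that is wanted. *)
Lemma le_one_plus_rpow (x q : R) : 1 <= q -> 0 <= x -> x <= 1 + rpow x q.
Proof.
  intros Hq Hx. destruct (Rle_lt_dec x 1) as [H|H].
  - pose proof (rpow_nonneg x q). lra.
  - unfold rpow. destruct Req_EM_T; [lra|].
    assert (x <= Rpower x q); [|lra].
    rewrite <- (Rpower_1 x) at 1 by lra. apply Rle_Rpower; lra.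
Qed.

Lemma rpow_inv_lt (x q b : R) : 1 <= q -> 0 <= x -> 0 < b -> rpow x (/ q) < b -> x <= Rpower b q.
Proof.
  intros Hq Hx Hb H. unfold rpow in H. destruct (Req_EM_T x 0) as [->|Hne].
  - left; apply exp_pos.
  - rewrite <- (Rpower_1 x) by lra. replace 1 with (/ q * q) by (field; lra).
    rewrite <- Rpower_mult. apply Rle_Rpower_l; [lra|]. split; [apply exp_pos | lra].
Qed.

(** [rpow] treats 0 apart, since [Rpower] does not vanish at base 0. Where u is positive, [rpow]
    agrees nearby with the smooth [Rpower]; at a zero of u it is squeezed by x^q <= x for x in
    [0, 1]. *)
Lemma continuous_rpow (u : R -> R) (q t : R) : 1 <= q -> (forall s, 0 <= u s) ->
  continuous u t -> continuous (fun s => rpow (u s) q) t.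
Proof.
  intros Hq Hpos Hu. destruct (Req_EM_T (u t) 0) as [E|Hne].
  - intros P [e He].
    assert (Hm : 0 < Rmin e 1) by (apply Rmin_pos; [apply e | lra]).
    destruct (Hu _ (locally_ball _ (mkposreal _ Hm))) as [d Hd]. exists d. intros s Hs.
    specialize (Hd s Hs). apply He.
    unfold ball in *; simpl in *; unfold AbsRing_ball, abs, minus, plus, opp in *; simpl in *.
    unfold rpow at 2. rewrite E in *. destruct (Req_EM_T 0 0); [|lra].
    rewrite Ropp_0, Rplus_0_r in *. specialize (Hpos s).
    rewrite Rabs_pos_eq in * by (try apply rpow_nonneg; assumption).
    pose proof (Rmin_l e 1). pose proof (Rmin_r e 1).
    eapply Rle_lt_trans; [apply rpow_le_self; lra | lra].
  - assert (Hp : 0 < u t) by (specialize (Hpos t); lra).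
    apply (continuous_ext_loc _ (fun s => Rpower (u s) q)).
    + destruct (Hu _ (locally_ball _ (mkposreal _ Hp))) as [d Hd]. exists d. intros s Hs.
      specialize (Hd s Hs). unfold rpow. destruct Req_EM_T as [E|]; [|reflexivity].
      exfalso. unfold ball in Hd; simpl in Hd; unfold AbsRing_ball, abs, minus, plus, opp in Hd; simpl in Hd.
      rewrite E, Rplus_0_l, Rabs_Ropp, Rabs_pos_eq in Hd; lra.
    + apply (continuous_comp u (fun x => Rpower x q)); [assumption|].
      apply (ex_derive_continuous (V := R_NormedModule)). unfold Rpower. auto_derive. assumption.
Qed.

Lemma continuous_on_circle (g : C -> C) (r t : R) :
  (forall w, Cmod w < 1 -> cdiff g w) -> 0 <= r < 1 ->
  continuous (fun s => Cmod (g (polar r s))) t.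
Proof.
  intros Hg Hr. apply continuous_Cmod. apply (ccont_comp g (polar r)).
  - apply Hg. rewrite Cmod_polar; lra.
  - apply ccont_pair; unfold polar; simpl; apply (ex_derive_continuous (V := R_NormedModule));
      auto_derive; auto.
Qed.

Lemma polar_reduce (r t : R) : exists t', 0 <= t' <= 2 * PI /\ polar r t = polar r t'.
Proof.
  pose proof PI_RGT_0 as HPI.
  set (k := Int_part (t / (2 * PI))).
  destruct (base_Int_part (t / (2 * PI))) as [H1 H2]. fold k in H1, H2.
  assert (E : t = t / (2 * PI) * (2 * PI)) by (field; lra).
  set (q := t / (2 * PI)) in *.
  exists ((q - IZR k) * (2 * PI)). split; [split; nra|].
  assert (Hcs : cos t = cos ((q - IZR k) * (2 * PI)) /\ sin t = sin ((q - IZR k) * (2 * PI))).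
  (* The periodicity lemmas take a natural number of periods, hence the split on the sign of k. *)
  { rewrite E. destruct (Z.le_gt_cases 0 k) as [Hk|Hk].
    - rewrite <- (Z2Nat.id k Hk), <- INR_IZR_INZ.
      replace (q * (2 * PI)) with ((q - INR (Z.to_nat k)) * (2 * PI) + 2 * INR (Z.to_nat k) * PI) by ring.
      split; [apply cos_period | apply sin_period].
    - assert (Hk' : IZR k = - INR (Z.to_nat (- k))).
      { rewrite INR_IZR_INZ, Z2Nat.id by lia. rewrite opp_IZR. ring. }
      rewrite Hk'.
      replace ((q - - INR (Z.to_nat (- k))) * (2 * PI)) with (q * (2 * PI) + 2 * INR (Z.to_nat (- k)) * PI) by ring.
      split; symmetry; [apply cos_period | apply sin_period]. }
  unfold polar. destruct Hcs as [-> ->]. reflexivity.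
Qed.

(** [real] sends an infinite supremum to 0, so finiteness must be shown first: the maximum over the
    compact interval [0, 2 pi] dominates all angles by periodicity. *)
Lemma hardy_infty_le (g : C -> C) (r t : R) :
  (forall w, Cmod w < 1 -> cdiff g w) -> 0 <= r < 1 ->
  Cmod (g (polar r t)) <= real (Lub_Rbar (fun y => exists t : R, y = Cmod (g (polar r t)))).
Proof.
  intros Hg Hr.
  destruct (continuity_ab_maj (fun s => Cmod (g (polar r s))) 0 (2 * PI)) as [x0 [Hx0 _]].
  { pose proof PI_RGT_0; lra. }
  { intros c _. apply continuity_pt_filterlim. apply (continuous_on_circle g r c Hg Hr). }
  set (S := fun y => exists t : R, y = Cmod (g (polar r t))).
  destruct (Lub_Rbar_correct S) as [Hub Hlub].
  assert (H1 : Rbar_le (Lub_Rbar S) (Cmod (g (polar r x0)))).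
  { apply Hlub. intros y [s ->]. destruct (polar_reduce r s) as [s' [Hs' ->]]. apply Hx0, Hs'. }
  assert (H2 : Rbar_le (Cmod (g (polar r t))) (Lub_Rbar S)) by (apply Hub; exists t; reflexivity).
  destruct (Lub_Rbar S); simpl in *; [assumption | contradiction | contradiction].
Qed.

(** [M] is chosen before g, while [rho] may depend on g: convergence of the Hardy means to a limit
    at most 1 bounds them only near the boundary. *)
Lemma circle_mean_bound (p : Rbar) : Rbar_le 1 p ->
  exists M, 0 <= M /\ forall g, in_Hp_unit_ball p g -> exists rho, rho < 1 /\
    forall r, rho < r < 1 -> exists m, is_RInt (fun y => Cmod (g (circ r y))) 0 1 m /\ m <= M.
Proof.
  intros Hp. pose proof PI_RGT_0 as HPI.
  assert (Hev : forall g, in_Hp_unit_ball p g -> exists rho, 0 <= rho < 1 /\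
     forall r, rho < r < 1 -> hardy_mean p g r < 2).
  { intros g [_ [L [HL HL1]]].
    (* Any threshold above 1 would do, since the limit is at most 1; 2 leads to M = 1 + 2^q for
       finite exponents and M = 2 at infinity. *)
    destruct (HL (fun x => x < 2)) as [d Hd].
    { apply open_lt. lra. }
    exists (Rmax 0 (1 - d)). split.
    { split; [apply Rmax_l|]. apply Rmax_lub_lt; [lra|]. destruct d; simpl; lra. }
    intros r Hr. apply Hd; [|lra].
    pose proof (Rmax_r 0 (1 - d)).
    unfold ball; simpl; unfold AbsRing_ball, abs, minus, plus, opp; simpl.
    apply Rabs_lt_between'. lra. }
  assert (Hcm : forall g r, in_Hp_unit_ball p g -> 0 <= r < 1 ->
     is_RInt (fun y => Cmod (g (circ r y))) 0 1 (RInt (fun y => Cmod (g (circ r y))) 0 1)).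
  { intros g r [Hg _] Hr. apply (RInt_correct (V := R_CompleteNormedModule)).
    apply (ex_RInt_continuous (V := R_CompleteNormedModule)). intros y _.
    apply continuous_Cmod. apply (ccont_comp g (circ r)); [|apply ccont_circ].
    apply ex_derive_cdiff, Hg. unfold in_disc, circ. rewrite Cmod_polar; lra. }
  destruct p as [q| |]; [| |contradiction].
  - simpl in Hp. exists (1 + Rpower 2 q). split; [pose proof (exp_pos (q * ln 2)); unfold Rpower; lra|].
    intros g Hball. destruct (Hev g Hball) as [rho [Hrho Hrho2]].
    exists rho. split; [lra|]. intros r Hr.
    exists (RInt (fun y => Cmod (g (circ r y))) 0 1).
    specialize (Hcm g r Hball ltac:(lra)). split; [exact Hcm|].
    assert (Hg : forall w, Cmod w < 1 -> cdiff g w)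
      by (intros w Hw; apply ex_derive_cdiff, (proj1 Hball), Hw).
    set (F := fun t => rpow (Cmod (g (polar r t))) q).
    assert (HF : ex_RInt F 0 (2 * PI)).
    { apply (ex_RInt_continuous (V := R_CompleteNormedModule)). intros t _.
      apply (continuous_rpow (fun t => Cmod (g (polar r t)))); [assumption | intros; apply Cmod_ge_0 |].
      apply continuous_on_circle; [assumption | lra]. }
    set (X := / (2 * PI) * RInt F 0 (2 * PI)).
    assert (HX0 : 0 <= X).
    { apply Rmult_le_pos; [left; apply Rinv_0_lt_compat; lra|].
      apply RInt_ge_0; [lra | exact HF | intros; apply rpow_nonneg]. }
    assert (HX : X <= Rpower 2 q) by (apply rpow_inv_lt; [lra | assumption | lra | exact (Hrho2 r Hr)]).
    assert (HI : is_RInt (fun y => 1 + F (2 * PI * y)) 0 1 (1 + X)).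
    { apply (is_RInt_plus (V := R_NormedModule)).
      - apply is_RInt_const_unit.
      - apply (is_RInt_ext (V := R_NormedModule) (fun y => scal (/ (2 * PI)) (scal (2 * PI) (F (2 * PI * y + 0))))).
        + intros y _. unfold scal; simpl; unfold mult; simpl. rewrite Rplus_0_r. field. lra.
        + unfold X. apply (is_RInt_scal (V := R_NormedModule)).
          apply (is_RInt_comp_lin (V := R_NormedModule)).
          rewrite Rmult_0_r, Rmult_1_r, !Rplus_0_r.
          apply (RInt_correct (V := R_CompleteNormedModule)), HF. }
    assert (RInt (fun y => Cmod (g (circ r y))) 0 1 <= 1 + X); [|lra].
    eapply is_RInt_le; [|exact Hcm|exact HI|]; [lra|].
    intros y _. apply le_one_plus_rpow; [lra | apply Cmod_ge_0].
  - exists 2. split; [lra|].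
    intros g Hball. destruct (Hev g Hball) as [rho [Hrho Hrho2]].
    exists rho. split; [lra|]. intros r Hr.
    exists (RInt (fun y => Cmod (g (circ r y))) 0 1).
    specialize (Hcm g r Hball ltac:(lra)). split; [exact Hcm|].
    pose proof (is_RInt_const_unit 2) as HI.
    eapply is_RInt_le; [|exact Hcm|exact HI|]; [lra|].
    intros y _. eapply Rle_trans; [|left; apply (Hrho2 r Hr)].
    apply hardy_infty_le; [|lra]. intros w Hw; apply ex_derive_cdiff, (proj1 Hball), Hw.
Qed.

(** Keeps the set under the supremum in [Cp] nonempty, so that its supremum is at least 0 rather
    than minus infinity. *)
Lemma zero_in_unit_ball (p : Rbar) : in_Hp_unit_ball p (fun _ => 0%C).
Proof.
  split.
  - intros z _. apply (ex_derive_const (K := C_AbsRing) (V := C_NormedModule)).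
  - exists 0. split; [|lra].
    apply filterlim_ext with (f := fun _ : R => 0); [|apply filterlim_const].
    intros r. symmetry.
    assert (Hlub : real (Lub_Rbar (fun y => exists t : R, y = Cmod 0)) = 0).
    { rewrite (is_lub_Rbar_unique _ (Finite 0)); [reflexivity|]. split.
      - intros y [_ ->]. rewrite Cmod_0. apply Rbar_le_refl.
      - intros b Hb. apply Hb. exists 0. symmetry. apply Cmod_0. }
    destruct p as [q| |]; simpl; [|exact Hlub|exact Hlub].
    rewrite (RInt_ext _ (fun _ => 0)).
    + rewrite RInt_const. unfold scal; simpl; unfold mult; simpl.
      rewrite !Rmult_0_r. unfold rpow. destruct Req_EM_T; [reflexivity | contradiction].
    + intros t _. rewrite Cmod_0. unfold rpow. destruct Req_EM_T; [reflexivity | contradiction].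
Qed.

Lemma Blaschke_small (zs : nat -> C) (R0 d : R) :
  R0 < 1 -> 0 < d ->
  is_lim_seq (sum_n (fun j => 1 - Cmod (zs j))) p_infty ->
  exists n, exp (- ((1 - R0) / 8 * lsumR (fun a => 1 - Cmod a) (first_points zs n))) <= d.
Proof.
  intros HR Hd Hlim.
  (* The threshold solves (1 - R0)/8 * s = - ln d. This is where divergence of the sum enters. *)
  destruct (Hlim (fun x => - ln d * (8 / (1 - R0)) < x)) as [n Hn].
  { exists (- ln d * (8 / (1 - R0))). auto. }
  exists n. specialize (Hn n (le_n _)). rewrite lsumR_first_points.
  set (s := sum_n _ n) in *.
  rewrite <- (exp_ln d Hd). left. apply exp_increasing.
  assert (H : (1 - R0) / 8 * (- ln d * (8 / (1 - R0))) < (1 - R0) / 8 * s)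
    by (apply Rmult_lt_compat_l; [lra | exact Hn]).
  replace ((1 - R0) / 8 * (- ln d * (8 / (1 - R0)))) with (- ln d) in H by (field; lra).
  lra.
Qed.

(** [eps0] precedes both g and z, which is exactly the uniformity needed to pass to the supremum in
    [Cp]. *)
Lemma pointwise_bound (E : C -> Prop) (p : Rbar) (Rad : R) :
  (forall z, E z -> in_disc z) -> Rbar_le (Finite 1) p -> 0 < Rad < 1 ->
  (exists zs : nat -> C,
      (forall j, E (zs j)) /\
      (forall i j, zs i = zs j -> i = j) /\
      is_lim_seq (sum_n (fun j => 1 - Cmod (zs j))) p_infty) ->
  forall e, 0 < e -> exists eps0, 0 < eps0 /\ forall eps g z, eps < eps0 ->
    in_Hp_unit_ball p g -> (forall zeta, E zeta -> Cmod (g zeta) <= eps) ->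
    Cmod z <= Rad -> Cmod (g z) <= e.
Proof.
  intros HE Hp HR [zs [Hzs [Hinj Hlim]]] e He.
  destruct (circle_mean_bound p Hp) as [M [HM Hmean]].
  (* Chosen so that d * 4/(1 - Rad) * M <= e / 2, where 4/(1 - Rad) * M will bound the remainder
     integral. *)
  set (d := e * (1 - Rad) / (8 * (M + 1))).
  assert (Hd : 0 < d) by (apply Rdiv_lt_0_compat; [apply Rmult_lt_0_compat|]; lra).
  destruct (Blaschke_small zs Rad d) as [n Hn]; [lra | assumption | assumption |].
  set (l := first_points zs n) in *.
  assert (HlE : forall a, In a l -> E a).
  { intros a Ha. destruct (In_first_points _ _ _ Ha) as [j [_ ->]]. apply Hzs. }
  assert (Hl : forall a, In a l -> Cmod a < 1) by (intros a Ha; apply HE, HlE, Ha).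
  assert (Hnd : NoDup l) by (apply NoDup_first_points, Hinj).
  assert (Hne : l <> nil) by (unfold l; destruct n; discriminate).
  destruct (interpolation_estimate l Hnd Hne Hl) as [K [r1 [HK [Hr1 Hest]]]].
  set (D := (1 - Rad) ^ length l).
  assert (HD : 0 < D) by (apply pow_lt; lra).
  (* The first bound serves z equal to a node; the second gives K eps <= D e / 2, where [D] is a
     lower bound for |[bden l z]|. *)
  set (eps0 := Rmin e (e / 2 * D / (K + 1))).
  assert (H0 : 0 < eps0).
  { apply Rmin_pos; [assumption|]. apply Rdiv_lt_0_compat; [apply Rmult_lt_0_compat|]; lra. }
  exists eps0. split; [assumption|].
  intros eps g z Heps Hball HgE Hz.
  pose proof (Rmin_l e (e / 2 * D / (K + 1))) as Hm1.
  pose proof (Rmin_r e (e / 2 * D / (K + 1))) as Hm2. fold eps0 in Hm1, Hm2.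
  destruct (in_dec Ceq_dec z l) as [Hzl|Hzl].
  { specialize (HgE z (HlE z Hzl)). lra. }
  destruct (Hmean g Hball) as [r2 [Hr2 Hr2']].
  (* Beyond r1 the interpolation estimate applies, beyond r2 the mean of |g| is at most M, and
     beyond (1 + Rad)/2 one has 2/(r - Rad) <= 4/(1 - Rad), whatever the r2 belonging to g. *)
  pose (rm := Rmax (Rmax r1 r2) ((1 + Rad) / 2)).
  assert (Hrm : rm < 1) by (repeat apply Rmax_lub_lt; lra).
  pose proof (Rmax_l (Rmax r1 r2) ((1 + Rad) / 2)) as A1. fold rm in A1.
  pose proof (Rmax_r (Rmax r1 r2) ((1 + Rad) / 2)) as A2. fold rm in A2.
  pose proof (Rmax_l r1 r2). pose proof (Rmax_r r1 r2).
  set (r := (rm + 1) / 2).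
  assert (Hr : rm < r < 1) by (unfold r; lra).
  destruct (Hr2' r) as [m [Hm HmM]]; [lra|].
  assert (Hm0 : 0 <= m).
  { eapply (is_RInt_le (fun _ => 0) _ 0 1); [lra | | exact Hm | intros; apply Cmod_ge_0].
    apply is_RInt_const_unit. }
  specialize (Hest g eps Rad r z m).
  assert (Hest' : Cmod (bden l z) * Cmod (g z) <= K * eps + Cmod (bnum l z) * (2 / (r - Rad) * m)).
  { apply Hest; auto; try lra. intros w Hw; apply ex_derive_cdiff, (proj1 Hball), Hw. }
  clear Hest.
  assert (HB : D <= Cmod (bden l z)).
  { apply Cmod_lprod_ge; [lra|]. intros a Ha.
    destruct (Cmod_bden_factor a z (Hl a Ha)) as [B _]. lra. }
  pose proof (Blaschke_product_upper l z Rad Hl ltac:(lra)) as HU.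
  set (b := Cmod (bden l z)) in *. set (w := Cmod (bnum l z)) in *.
  assert (Hw : w <= d * b).
  { eapply Rle_trans; [exact HU|]. apply Rmult_le_compat_r; lra. }
  assert (Hq : 2 / (r - Rad) * m <= 4 / (1 - Rad) * M).
  { apply Rmult_le_compat; try assumption.
    - apply Rmult_le_pos; [lra | left; apply Rinv_0_lt_compat; lra].
    - apply Rle_div_l; [lra|]. replace (4 / (1 - Rad) * (r - Rad)) with (4 * (r - Rad) / (1 - Rad)) by (field; lra).
      apply (Rle_div_r 2 _ (1 - Rad)); lra. }
  assert (Hq0 : 0 <= 2 / (r - Rad) * m).
  { apply Rmult_le_pos; [|assumption]. apply Rmult_le_pos; [lra | left; apply Rinv_0_lt_compat; lra]. }
  assert (Hd2 : d * (4 / (1 - Rad) * M) <= e / 2).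
  { replace (d * (4 / (1 - Rad) * M)) with (e / 2 * (M / (M + 1))) by (unfold d; field; lra).
    rewrite <- (Rmult_1_r (e / 2)) at 2. apply Rmult_le_compat_l; [lra|].
    apply Rle_div_l; lra. }
  assert (HT2 : w * (2 / (r - Rad) * m) <= b * (e / 2)).
  { eapply Rle_trans; [apply Rmult_le_compat; [apply Cmod_ge_0 | exact Hq0 | exact Hw | exact Hq]|].
    replace (d * b * (4 / (1 - Rad) * M)) with (b * (d * (4 / (1 - Rad) * M))) by ring.
    apply Rmult_le_compat_l; [apply Cmod_ge_0 | exact Hd2]. }
  assert (HT1 : K * eps <= b * (e / 2)).
  { assert (Heps2 : eps <= e / 2 * D / (K + 1)) by lra.
    apply Rle_trans with (K * (e / 2 * D / (K + 1))); [apply Rmult_le_compat_l; assumption|].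
    apply Rle_trans with (D * (e / 2)); [|apply Rmult_le_compat_r; lra].
    replace (K * (e / 2 * D / (K + 1))) with (D * (e / 2) * (K / (K + 1))) by (field; lra).
    rewrite <- (Rmult_1_r (D * (e / 2))) at 2.
    apply Rmult_le_compat_l; [apply Rmult_le_pos; lra|]. apply Rle_div_l; lra. }
  (* Both terms are at most b e / 2, and b >= D > 0 cancels. *)
  apply (Rmult_le_reg_l b); lra.
Qed.

Theorem theorem1p1 (E : C -> Prop) (p : Rbar) (Rad : R) :
  (forall z, E z -> in_disc z) ->
  ~ (exists l : list C, forall z, E z -> In z l) ->
  Rbar_le (Finite 1) p ->
  0 < Rad < 1 ->
  (exists zs : nat -> C,
      (forall j, E (zs j)) /\
      (forall i j, zs i = zs j -> i = j) /\
      is_lim_seq (sum_n (fun j => 1 - Cmod (zs j))) p_infty) ->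
  filterlim (fun eps => Cp p E eps Rad) (at_right 0) (Rbar_locally (Finite 0)).
Proof.
  intros HE _ Hp HR Hzs P [e HP].
  (* Half of e, because a supremum inherits only a weak inequality while the ball is open. *)
  destruct (pointwise_bound E p Rad HE Hp HR Hzs (e / 2)) as [eps0 [H0 Hb]].
  { destruct e; simpl; lra. }
  exists (mkposreal eps0 H0). intros eps Heps Hpos.
  unfold ball in Heps; simpl in Heps; unfold AbsRing_ball, abs, minus, plus, opp in Heps; simpl in Heps.
  rewrite Ropp_0, Rplus_0_r in Heps.
  apply Rabs_lt_between in Heps.
  unfold Cp. set (S := fun x : R => _).
  destruct (Lub_Rbar_correct S) as [Hub Hlub].
  assert (H1 : Rbar_le (Lub_Rbar S) (e / 2)).
  { apply Hlub. intros x [g [z [Hg [HgE [Hz ->]]]]]. simpl. apply (Hb eps g z); auto. lra. }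
  (* The zero function and the point 0 witness nonnegativity; with [H1] this makes the supremum a
     finite real. *)
  assert (H2 : Rbar_le 0 (Lub_Rbar S)).
  { apply Hub. exists (fun _ => 0%C), 0%C.
    split; [apply zero_in_unit_ball|]. rewrite Cmod_0. repeat split; intros; lra. }
  destruct (Lub_Rbar S) as [x| |]; simpl in *; try contradiction.
  apply HP. unfold ball; simpl; unfold AbsRing_ball, abs, minus, plus, opp; simpl.
  rewrite Ropp_0, Rplus_0_r, Rabs_pos_eq by assumption. destruct e; simpl in *; lra.
Qed.
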